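(* Let $r\geq 4$ and let $\mathcal{H}$ be an $r$-graph on $s$ vertices that is embeddable in a $2$-reducible $r$-tree. Let $\sigma=\sigma(\mathcal{H})$, suppose $\sigma\geq 2$, and define $\beta:=1/((r-2)(\sigma+1)+1)$. There is $n(r,s)$, depending only on $r$ and $s$, such that the following holds for all $n\geq n(r,s)$ and every $K\geq 0$. If $\mathcal{F}\subseteq\binom{[n]}{r}$ does not contain $\mathcal{H}$ and $$|\mathcal{F}|\geq(\sigma-1)\binom{n}{r-1}-Kn^{r-1-\beta},$$ then there exists a set $A\subseteq[n]$ of $\sigma-1$ vertices such that $$|\mathcal{L}_{\mathcal{F}}(A)|\geq\binom{n}{r-1}-(r-1)(K+2s^2)n^{r-1-\beta},$$ and all but at most $\left((\sigma-1)(r-1)(K+2s^2)+2s^2\right)n^{r-1-\beta}$ members of $\mathcal{F}$ meet $A$ in exactly one element.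
   Context: An $r$-graph is an $r$-uniform hypergraph. An $r$-tree is an $r$-uniform hypergraph whose edges can be ordered $E_1,\dots,E_m$ so that for each $i>1$ there is $\alpha(i)<i$ with $E_i\cap\bigcup_{j<i}E_j\subseteq E_{\alpha(i)}$. It is $2$-reducible if each edge contains at least $2$ vertices of degree $1$. $\mathcal{H}$ is embeddable in $\mathcal{T}$ if it is isomorphic to a subgraph of $\mathcal{T}$. A cross-cut of $\mathcal{H}$ is a vertex set containing exactly one vertex of each edge; $\sigma(\mathcal{H})$ is the minimum size of a cross-cut. For $A\subseteq[n]$, the common link graph is $\mathcal{L}_{\mathcal{F}}(A)=\{D\subseteq[n]\setminus A:\ D\cup\{a\}\in\mathcal{F}\text{ for all }a\in A\}$. *)

(* Defs.v *)
From mathcomp Require Import all_boot.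

Set Implicit Arguments.
Unset Strict Implicit.
Unset Printing Implicit Defensive.

(* A hypergraph on the finite vertex type V is its edge set H : {set {set V}}. *)

Definition is_rgraph (V : finType) (r : nat) (H : {set {set V}}) : bool :=
  [forall e in H, #|e| == r].

Definition degree (V : finType) (H : {set {set V}}) (v : V) : nat :=
  #|[set e in H | v \in e]|.

(* The edge order E_1, ..., E_m is the duplicate-free sequence E, indexed from
   0, so that the condition "i > 1" becomes "0 < i". *)
Definition is_rtree (V : finType) (r : nat) (T : {set {set V}}) : Prop :=
  is_rgraph r T /\
  exists E : seq {set V},
    [/\ uniq E, E =i T
      & forall i, 0 < i < size E ->
          exists2 a, a < i &
            nth set0 E i :&: \bigcup_(j < i) nth set0 E j \subset nth set0 E a].

Definition reducible2 (V : finType) (T : {set {set V}}) : bool :=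
  [forall e in T, 2 <= #|[set v in e | degree T v == 1]|].

(* H is isomorphic to a (not necessarily induced) subgraph of G. *)
Definition embeddable (V W : finType) (H : {set {set V}}) (G : {set {set W}})
    : Prop :=
  exists2 f : V -> W, injective f & forall e, e \in H -> f @: e \in G.

Definition cross_cut (V : finType) (H : {set {set V}}) (S : {set V}) : bool :=
  [forall e in H, #|e :&: S| == 1].

(* The default #|V| bounds every #|S|, so it does not affect the minimum as
   soon as H has a cross-cut.  This is the case when H embeds in a 2-reducible
   r-tree: pick in each edge a vertex whose image has degree 1. *)
Definition cross_cut_number (V : finType) (H : {set {set V}}) : nat :=
  \big[minn/#|V|]_(S : {set V} | cross_cut H S) #|S|.

Definition common_link (V : finType) (F : {set {set V}}) (A : {set V})
    : {set {set V}} :=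
  [set D : {set V} | (D \subset ~: A) && [forall a in A, D :|: [set a] \in F]].

Definition not_meeting_once (V : finType) (F : {set {set V}}) (A : {set V})
    : {set {set V}} :=
  [set e in F | #|e :&: A| != 1].

(* Main.v *)
(* Call a set P a kernel if the edges of F through P cannot all be hit outside P
   by t vertices, where t bounds the size of the tree T containing H.  A
   nonempty family of (r-2)-sets that are kernels of F, and in which every
   (r-3)-subset can be extended freely, would contain the (r-2)-uniform cores
   of T, hence F would contain T.  With a homogeneous subfamily (in the style of
   Furedi's intersection semilattice lemma) this shows that all but O(n^(r-2))
   edges e of F have a center x: every e \ y with y <> x is a kernel, while no
   (r-2)-subset of e \ x is one.

   A non-kernel B has at most t apexes, i.e. vertices x such that B + x is a
   kernel.  Hence there are few heavy vertices (apexes of many such B), and by a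
   Kruskal-Katona argument few edges have a light center.  If sigma heavy
   vertices had more than t C(n, r-3) common apex sets B, a minimum cross-cut of
   H could be mapped to them and H would embed.  So, up to the error term, every
   (r-1)-set D is completed by at most sigma-1 heavy centers.  Since F is large,
   most D have exactly sigma-1, and two such D sharing an (r-2)-set have the same
   centers.  An isoperimetric argument in the Johnson graph then yields one set A
   that is the set of centers of almost all D. *)

Require Import Defs.
From mathcomp Require Import all_boot all_order all_algebra.
From mathcomp Require boolp.
From mathcomp Require Import reals exp.
From mathcomp Require Import zify lra.

Set Implicit Arguments.
Unset Strict Implicit.
Unset Printing Implicit Defensive.

(** * Double counting and unions *)

Lemma double_count (T U : finType) (A : {set T}) (B : {set U}) (R : T -> U -> bool) :
  \sum_(x in A) #|[set y in B | R x y]| = \sum_(y in B) #|[set x in A | R x y]|.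
Proof.
transitivity (\sum_(x in A) \sum_(y in B) (R x y : nat)).
  apply: eq_bigr => x _; rewrite -sum1dep_card big_mkcondr.
  by apply: eq_bigr => y _; case: (R x y).
rewrite exchange_big; apply: eq_bigr => y _; rewrite -sum1dep_card big_mkcondr.
by apply: eq_bigr => x _; case: (R x y).
Qed.

Lemma card_bigcup_leq (T I : finType) (U : {pred I}) (f : I -> {set T}) :
  #|\bigcup_(i in U) f i| <= \sum_(i in U) #|f i|.
Proof.
elim/big_rec2: _ => [|i n A _ le]; first by rewrite cards0.
by rewrite (leq_trans (leq_card_setU _ _)) // leq_add2l.
Qed.


(** * Kernels and greedy embeddings of trees *)

(* Up to the value of t: P is the kernel of a sunflower with t petals in F. *)
Definition robust (V : finType) (t : nat) (F : {set {set V}}) (P : {set V}) :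
    bool :=
  [forall U : {set V}, (#|U| <= t) ==>
     [exists e in F, (P \subset e) && (e :&: U \subset P)]].

Lemma robustP (V : finType) t (F : {set {set V}}) (P : {set V}) :
  reflect (forall U : {set V}, #|U| <= t ->
             exists e, [/\ e \in F, P \subset e & e :&: U \subset P])
          (robust t F P).
Proof.
apply: (iffP forallP) => [h U hU | h U].
  have /implyP/(_ hU)/exists_inP[e eF /andP[Pe eU]] := h U.
  by exists e.
apply/implyP => /h[e [eF Pe eU]]; apply/exists_inP; exists e => //.
by rewrite Pe.
Qed.

Lemma robustPn (V : finType) t (F : {set {set V}}) (P : {set V}) :
  ~~ robust t F P ->
  exists2 U : {set V}, #|U| <= t &
    forall e, e \in F -> P \subset e -> exists2 u, u \in e :&: U & u \notin P.
Proof.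
rewrite negb_forall => /existsP[U]; rewrite negb_imply => /andP[hU].
rewrite negb_exists_in => /forall_inP h; exists U => // e eF Pe.
by have := h e eF; rewrite Pe /= => /subsetPn.
Qed.

Lemma robust_mono (V : finType) t (F G : {set {set V}}) (P : {set V}) :
  F \subset G -> robust t F P -> robust t G P.
Proof.
move=> FG /robustP h; apply/robustP => U /h[e [eF Pe eU]].
by exists e; split=> //; apply: (subsetP FG).
Qed.

(** The extension step of every embedding below: [X] is already placed, and the new vertices [Y] go
    to the fresh vertices [Z], matched in enumeration order. *)
Lemma inj_into (W V : finType) (X Y : {set W}) (Z : {set V}) (f : W -> V) :
  {in X &, injective f} -> [disjoint X & Y] -> #|Y| <= #|Z| ->
  [disjoint f @: X & Z] ->
  exists g : W -> V,
    [/\ {in X, g =1 f}, {in X :|: Y &, injective g} & g @: Y \subset Z].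
Proof.
move=> finj dXY leYZ dfZ.
pose g w := if w \in Y then nth (f w) (enum Z) (index w (enum Y)) else f w.
have idx w : w \in Y -> index w (enum Y) < size (enum Z).
  move=> wY; apply: leq_trans (_ : #|Y| <= _); last by rewrite -cardE.
  by rewrite cardE index_mem mem_enum.
have gY w : w \in Y -> g w \in Z.
  by move=> wY; rewrite /g wY -mem_enum mem_nth ?idx.
have gX w : w \in X -> g w = f w.
  by move=> wX; rewrite /g (disjointFr dXY wX).
have gXY w w' : w \in X -> w' \in Y -> g w <> g w'.
  move=> wX wY gg; move: (gY _ wY); rewrite -gg gX // => fZ.
  by move: (disjointFr dfZ (imset_f f wX)); rewrite fZ.
exists g; split => //; last by apply/subsetP => _ /imsetP[w wY ->]; apply: gY.
move=> w w' /setUP[wX|wY] /setUP[wX'|wY'].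
- by rewrite !gX //; apply: finj.
- by move/gXY => /(_ wX wY').
- by move/esym/gXY => /(_ wX' wY).
- rewrite /g wY wY' (set_nth_default (f w) (f w')) ?idx // => /eqP.
  rewrite nth_uniq ?idx ?enum_uniq // => /eqP ii.
  by rewrite -(nth_index w (_ : w \in enum Y)) ?mem_enum // ii nth_index ?mem_enum.
Qed.

(** Start from [b] and remove the vertices of [U] outside [z] one at a time: if [i] is one, the
    kernel [b :\ i] yields another member of [B] that still contains [z], lacks [i], and meets [U]
    in no new vertex. *)
Lemma robust_sub (V : finType) t (B : {set {set V}}) :
  (forall b i, b \in B -> i \in b -> robust t B (b :\ i)) ->
  forall b z : {set V}, b \in B -> z \subset b -> robust t B z.
Proof.
move=> full b z bB zb; apply/robustP => U hU.
have [m] := ubnP #|(b :&: U) :\: z|.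
elim: m b bB zb => // m IH b bB zb hm.
have [sub|/subsetPn[i]] := boolP (b :&: U \subset z); first by exists b.
move=> ibU iz; have ib : i \in b by case/setIP: ibU.
have /robustP/(_ U hU)[b' [b'B sub' sub'']] := full b i bB ib.
have zb' : z \subset b'.
  apply: subset_trans sub'; apply/subsetP => v vz.
  rewrite !inE (subsetP zb) // andbT.
  by apply: contraNneq iz => <-.
apply: (IH b') => //.
have : (b' :&: U) :\: z \proper (b :&: U) :\: z.
  apply/properP; split.
    apply/subsetP => v; rewrite !inE => /and3P[-> vb' vU] /=.
    by have := subsetP sub'' v; rewrite !inE vb' vU => /(_ isT)/andP[_ ->].
  exists i; first by rewrite inE iz ibU.
  apply/negP; rewrite !inE => /and3P[_ ib' iU].
  by have := subsetP sub'' i; rewrite !inE ib' iU eqxx => /(_ isT).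
by move/proper_card => lt; apply: leq_trans lt _; rewrite -ltnS.
Qed.

(** The order condition of [is_rtree] stated vertex by vertex and without uniqueness: it is applied
    to the cores of edges, and distinct edges may have equal cores. *)
Definition tree_seq (W : finType) (E : seq {set W}) : Prop :=
  forall i, 0 < i < size E -> exists2 a, a < i &
    forall w j, j < i -> w \in nth set0 E i -> w \in nth set0 E j ->
      w \in nth set0 E a.

(** Greedy embedding. The placed vertices of a new set lie in one earlier set, so their image lies
    in a member of [B] and is a kernel by [robust_sub]; this gives a member of [B] that is otherwise
    disjoint from the image so far. Sets smaller than [k] are allowed, hence the inclusion in
    [b]. *)
Lemma tree_seq_embed (W V : finType) t k (E : seq {set W})
    (B : {set {set V}}) (f0 : W -> V) :
  tree_seq E -> (forall e, e \in E -> #|e| <= k) -> #|W| <= t ->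
  B != set0 -> (forall b, b \in B -> #|b| = k) ->
  (forall b i, b \in B -> i \in b -> robust t B (b :\ i)) ->
  exists f : W -> V, {in \bigcup_(e <- E) e &, injective f} /\
    forall e, e \in E -> exists2 b, b \in B & f @: e \subset b.
Proof.
move=> tree Ek Wt /set0Pn[b0 b0B] Bk full.
suff main m : m <= size E -> exists f : W -> V,
    {in \bigcup_(j < m) nth set0 E j &, injective f} /\
    forall j, j < m -> exists2 b, b \in B & f @: nth set0 E j \subset b.
  have [f [finj fB]] := main _ (leqnn _); exists f; split.
    by rewrite (big_nth set0) big_mkord.
  by move=> e /(nthP set0)[j jE <-]; apply: fB.
elim: m => [_|m IH ltm].
  exists f0; split => //.
  by move=> w w'; rewrite big_ord0 inE.
have [f [finj fB]] := IH (ltnW ltm).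
set X := \bigcup_(j < m) nth set0 E j in finj.
set e := nth set0 E m.
have eE : e \in E by apply: mem_nth.
have [b bB fb] : exists2 b, b \in B & f @: (e :&: X) \subset b.
  case: (posnP m) => [m0|mgt].
    exists b0 => //; rewrite /X; apply/subsetP => v /imsetP[w]; rewrite inE.
    by move=> /andP[_ /bigcupP[j]]; have := ltn_ord j; rewrite {2}m0.
  have mE : 0 < m < size E by rewrite mgt.
  have [a am sub] := tree m mE; have [b bB fb] := fB a am; exists b => //.
  apply: subset_trans fb; apply/imsetS/subsetP => w /setIP[we /bigcupP[j _ wj]].
  exact: (sub w j).
have cardU : #|f @: X| <= t.
  by apply: leq_trans Wt; apply: leq_trans (leq_imset_card _ _) (max_card _).
have /robustP/(_ _ cardU)[b' [b'B sub1 sub2]] := robust_sub full bB fb.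
have injI : {in e :&: X &, injective f}.
  by move=> w w' /setIP[_ ?] /setIP[_ ?]; apply: finj.
have [|||g [gf ginj gZ]] := @inj_into W V X (e :\: X) (b' :\: f @: (e :&: X)) f finj.
- by rewrite disjoint_sym disjoints_subset setDE subsetIr.
- rewrite -(leq_add2l #|e :&: X|) cardsID.
  have <- : #|f @: (e :&: X)| = #|e :&: X| by rewrite card_in_imset.
  by rewrite -{1}(setIidPr sub1) cardsID (Bk b') // Ek.
- rewrite disjoint_sym disjoints_subset; apply/subsetP => v /setDP[vb vn].
  by rewrite inE; apply: contra vn => vX; apply: (subsetP sub2); rewrite inE vb.
have UE : \bigcup_(j < m.+1) nth set0 E j = X :|: (e :\: X).
  by rewrite big_ord_recr /= setDE setUIr setUCr setIT.
exists g; split; first by rewrite UE.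
have gX : forall A : {set W}, A \subset X -> g @: A = f @: A.
  by move=> A AX; apply: eq_in_imset => w wA; apply: gf; apply: (subsetP AX).
move=> j; rewrite ltnS leq_eqVlt => /predU1P[->|jm].
  exists b' => //; rewrite -/e -(setID e X) imsetU gX ?subsetIr //.
  by rewrite subUset sub1 (subset_trans gZ) // subsetDl.
have [b1 b1B fb1] := fB j jm; exists b1 => //; rewrite gX //.
exact: (bigcup_sup (Ordinal jm)).
Qed.

(** The edges of [H] are completed one after the other. Since a vertex outside [X] lies in one edge
    only, the sole constraint on the image of [e] is that it contains [f @: (e :&: X)], and the
    kernel property supplies an edge of [F] that is otherwise new. *)
Lemma extend_private (W V : finType) t r (H : {set {set W}}) (F : {set {set V}})
    (X : {set W}) (f : W -> V) :
  #|W| <= t -> is_rgraph r F -> {in X &, injective f} ->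
  (forall e, e \in H -> #|e| = r) ->
  (forall e e' w, e \in H -> e' \in H -> w \in e -> w \in e' -> w \notin X ->
     e = e') ->
  (forall e, e \in H -> robust t F (f @: (e :&: X))) ->
  exists2 g : W -> V, {in X :|: cover H &, injective g} &
    forall e, e \in H -> g @: e \in F.
Proof.
move=> Wt /forall_inP Fr finj Hr priv rob.
suff main (s : seq {set W}) : uniq s -> {subset s <= H} -> exists g : W -> V,
   [/\ {in X, g =1 f}, {in X :|: \bigcup_(e <- s) e &, injective g} &
    forall e, e \in s -> g @: e \in F].
  have [|e|g [gf ginj gF]] := main (enum H); rewrite ?enum_uniq ?mem_enum //.
  exists g => [|e eH]; last by apply: gF; rewrite mem_enum.
  by rewrite big_enum in ginj.
elim: s => [_ _|e s IH /= /andP[es us] sub].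
  by exists f; split => //; rewrite big_nil setU0.
have [//|e' e's|g [gf ginj gF]] := IH; first by apply: sub; rewrite inE e's orbT.
have eH : e \in H by apply: sub; rewrite inE eqxx.
set D := X :|: _ in ginj.
have DX : e :&: D = e :&: X.
  apply/setP => w; rewrite !inE; case we: (w \in e) => //=.
  case wX: (w \in X) => //=; apply/negP => wD.
  have [e' e's we'] : exists2 e', e' \in s & w \in e'.
    by move: wD; rewrite bigcup_seq => /bigcupP[e' e's we']; exists e'.
  move: es; rewrite (priv e e' w) ?wX ?e's //.
  by apply: sub; rewrite inE e's orbT.
have cardU : #|g @: D| <= t.
  by apply: leq_trans Wt; apply: leq_trans (leq_imset_card _ _) (max_card _).
have /robustP/(_ _ cardU)[e' [e'F sub1 sub2]] := rob e eH.
have gX : g @: (e :&: X) = f @: (e :&: X).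
  by apply: eq_in_imset => w /setIP[_ wX]; apply: gf.
have injI : {in e :&: X &, injective f}.
  by move=> w w' /setIP[_ ?] /setIP[_ ?]; apply: finj.
have card_e' : #|e'| = r by apply/eqP/Fr.
have [|||h [hg hinj hZ]] := @inj_into W V D (e :\: D) (e' :\: f @: (e :&: X)) g ginj.
- by rewrite disjoint_sym disjoints_subset setDE subsetIr.
- rewrite -(leq_add2l #|e :&: D|) cardsID DX -(card_in_imset injI).
  by rewrite -{1}(setIidPr sub1) cardsID card_e' Hr.
- rewrite disjoint_sym disjoints_subset; apply/subsetP => v /setDP[vb vn].
  by rewrite inE; apply: contra vn => vX; apply: (subsetP sub2); rewrite inE vb.
have UE : X :|: \bigcup_(e1 <- e :: s) e1 = D :|: (e :\: D).
  by rewrite big_cons setUCA setUC -/D setDE setUIr setUCr setIT.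
rewrite UE; exists h; split => //.
  by move=> w wX; rewrite hg ?gf // inE wX.
have hD (A : {set W}) : A \subset D -> h @: A = g @: A.
  by move=> AX; apply: eq_in_imset => w /(subsetP AX)/hg.
move=> e1; rewrite inE => /predU1P[->|e1s]; last first.
  rewrite hD ?gF // /D; apply: subset_trans (subsetUr _ _).
  by rewrite bigcup_seq; apply: bigcup_sup.
suff -> : h @: e = e' by [].
apply/eqP; rewrite eqEcard card_e' card_in_imset.
  rewrite Hr // leqnn andbT -(setID e D) imsetU hD ?subsetIr // DX gX.
  by rewrite subUset sub1 (subset_trans hZ) // subsetDl.
by move=> w w' we we'; apply: hinj; rewrite -UE big_cons !inE ?we ?we' orbT.
Qed.

(* S is sent into A, the vertices of Y e are private to e, and the remaining
   cores form a tree that is embedded in the full family B. *)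
Lemma skeleton_embed (W V : finType) t k r (E : seq {set W}) (H : {set {set W}})
    (S : {set W}) (Y : {set W} -> {set W}) (F B : {set {set V}}) (A : {set V}) :
  #|W| <= t -> #|W| <= #|V| ->
  tree_seq E -> {subset H <= E} -> (forall e, e \in H -> #|e| = r) ->
  (forall e e' w, e \in E -> e' \in E -> w \in Y e -> w \in e' -> e = e') ->
  (forall e, e \in E -> #|e :\: (Y e :|: S)| <= k) ->
  (forall e, e \in H -> #|e :\: (Y e :|: S)| = k) ->
  is_rgraph r F -> #|S| <= #|A| ->
  B != set0 -> (forall b, b \in B -> #|b| = k) ->
  (forall b, b \in B -> [disjoint b & A]) ->
  (forall b i, b \in B -> i \in b -> robust t B (b :\ i)) ->
  (forall b e (A' : {set V}), b \in B -> e \in H -> A' \subset A ->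
     #|A'| = #|e :&: S| -> robust t F (A' :|: b)) ->
  embeddable H F.
Proof.
move=> Wt WV tree HE Hr priv Ek Hk Fr SA B0 Bk BA full rob.
have f0_inj : injective (fun w : W => enum_val (widen_ord WV (enum_rank w))).
  move=> w w' /enum_val_inj ii; apply: enum_rank_inj; apply/val_inj.
  by rewrite /= in ii *; apply: (congr1 val ii).
set f0 := fun w : W => _ in f0_inj.
pose c (e : {set W}) := e :\: (Y e :|: S).
have treec : tree_seq [seq c e | e <- E].
  move=> i; rewrite size_map => iE; have [a ai sub] := tree i iE.
  case/andP: iE => _ iE; exists a => // w j ji.
  have jE := ltn_trans ji iE; have aE := ltn_trans ai iE.
  rewrite !(nth_map set0) // !inE !negb_or => /andP[/andP[wYi wS] wi].
  move=> /andP[/andP[wYj _] wj]; rewrite wS (sub w j) ?andbT //.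
  apply: contra wYi => wYa; rewrite -(priv _ _ _ _ _ wYa wi) ?mem_nth //.
have Ekc (e : {set W}) : e \in [seq c e | e <- E] -> #|e| <= k.
  by case/mapP => e' e'E ->; apply: Ek.
have [f [finj fB]] := tree_seq_embed f0 treec Ekc Wt B0 Bk full.
set X := \bigcup_(e <- _) e in finj.
have memX w : reflect (exists2 e, e \in E & w \in c e) (w \in X).
  rewrite /X bigcup_seq; apply: (iffP bigcupP) => [[e /mapP[e' ? ->]]|[e eE we]].
    by exists e'.
  by exists (c e) => //; apply: map_f.
have fXA v : v \in f @: X -> v \notin A.
  case/imsetP => w /memX[e eE we] ->.
  have [|b bB /subsetP fb] := fB (c e); first exact: map_f.
  by rewrite (disjointFr (BA b bB)) // fb // imset_f.
have [|||g [gf ginj gA]] := @inj_into W V X S A f finj.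
- rewrite disjoints_subset; apply/subsetP => w /memX[e eE].
  by rewrite !inE negb_or => /andP[/andP[]].
- by [].
- by rewrite disjoints_subset; apply/subsetP => v /fXA; rewrite inE.
have eX (e : {set W}) : e \in H -> e :&: (X :|: S) = c e :|: (e :&: S).
  move=> eH; apply/setP => w; rewrite !inE negb_or.
  case we: (w \in e) => /=; last by rewrite andbF.
  case wS: (w \in S) => //=; rewrite ?andbF ?orbT // !orbF !andbT.
  apply/memX/idP => [[e' e'E]|wY]; last first.
    by exists e; rewrite ?HE // !inE wS we (negbTE wY).
  rewrite !inE wS orbF => /andP[wY' we']; apply: contra wY' => wY.
  by rewrite -(priv e e' w) // HE.
have gX (e : {set W}) : e \in H -> exists b (A' : {set V}), [/\ b \in B, A' \subset A, #|A'| = #|e :&: S|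
    & g @: (e :&: (X :|: S)) = A' :|: b].
  move=> eH; have [|b bB fb] := fB (c e); first by apply/map_f/HE.
  exists b, (g @: (e :&: S)); split => //.
  - by apply: subset_trans gA; apply/imsetS/subsetIr.
  - rewrite card_in_imset // => w w' /setIP[_ wS] /setIP[_ wS'].
    by apply: ginj; rewrite inE ?wS ?wS' orbT.
  rewrite eX // imsetU setUC; congr (_ :|: _).
  have -> : g @: c e = f @: c e.
    apply: eq_in_imset => w wc; apply: gf; apply/memX; exists e => //; exact: HE.
  apply/eqP; rewrite eqEcard fb Bk // card_in_imset ?Hk ?leqnn //.
  move=> w w' wc wc'; apply: finj; apply/memX; exists e => //; exact: HE.
have [||h hinj hF] := @extend_private W V t r H F (X :|: S) g Wt Fr ginj Hr.
- move=> e e' w eH e'H we we' wX.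
  have wYe : w \in Y e; last by apply: (priv e e' w) => //; apply: HE.
  apply: contraNT wX => wY; rewrite !inE; case wS: (w \in S); rewrite ?orbT ?orbF //.
  by apply/memX; exists e; rewrite ?HE // !inE wS we (negbTE wY).
- by move=> e eH; have [b [A' [bB AA' cA' ->]]] := gX e eH; apply: (rob b e).
have [|||h' [hh' h'inj _]] := @inj_into W V (X :|: S :|: cover H)
    (~: (X :|: S :|: cover H)) (~: (h @: (X :|: S :|: cover H))) h hinj.
- by rewrite disjoints_subset setCK.
- rewrite -(leq_add2l #|X :|: S :|: cover H|) cardsC.
  by rewrite -{1}(card_in_imset hinj) cardsC.
- by rewrite disjoints_subset setCK.
exists h' => [w w'|e eH]; first by apply: h'inj; rewrite setUCr inE.
have -> : h' @: e = h @: e; last exact: hF.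
apply: eq_in_imset => w we; apply: hh'; rewrite inE; apply/orP; right.
by apply/bigcupP; exists e.
Qed.

Lemma pigeonhole_cover (T I : finType) (X : {set T}) (U : {set I})
    (f : I -> {set T}) :
  X \subset \bigcup_(i in U) f i -> X != set0 ->
  exists2 i, i \in U & #|X| <= #|U| * #|f i|.
Proof.
move=> /[dup] XU /subset_leq_card leX /set0Pn[x /(subsetP XU)/bigcupP[i0 i0U _]].
have [i iU imax] := arg_maxnP (fun i => #|f i|) i0U; exists i => //.
apply: leq_trans leX _; rewrite -sum_nat_const.
by apply: leq_trans (card_bigcup_leq _ _) _; apply: leq_sum => j /imax.
Qed.

(* If P is not full, some z in Z has at most m extensions in P; delete z and
   these extensions. *)
Lemma full_subfamily (V : finType) k m (P Z : {set {set V}}) :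
  (forall b, b \in P -> #|b| = k) ->
  (forall b i, b \in P -> i \in b -> b :\ i \in Z) ->
  m * #|Z| < #|P| ->
  exists B : {set {set V}}, [/\ B \subset P, B != set0 &
    forall b i, b \in B -> i \in b -> robust m B (b :\ i)].
Proof.
have [N] := ubnP #|P|; elim: N P Z => // N IH P Z ltN Pk PZ ltP.
have [/forall_inP good|] := boolP [forall b in P, [forall i in b, robust m P (b :\ i)]].
  exists P; split => // [|b i bP ib]; last by have /forall_inP := good b bP; apply.
  by rewrite -card_gt0 (leq_ltn_trans _ ltP).
rewrite negb_forall_in => /exists_inP[b bP].
rewrite negb_forall_in => /exists_inP[i ib /robustPn[U Um cov]].
pose z := b :\ i; pose P' := [set e in P | ~~ (z \subset e)].
pose X := [set e in P | z \subset e].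
have zk : k = #|z|.+1 by rewrite -(Pk b bP) (cardsD1 i) ib.
(* A member of [P] containing [z] has exactly one further vertex, and this vertex must lie in
   [U]. *)
have Xm : #|X| <= m.
  apply: leq_trans Um; apply: leq_trans (leq_imset_card (fun u => u |: z) _).
  apply/subset_leq_card/subsetP => e; rewrite inE => /andP[eP ze].
  have [u /setIP[ue uU] uz] := cov e eP ze; apply/imsetP; exists u => //.
  apply/eqP; rewrite eq_sym eqEcard subUset sub1set ue ze /= cardsU1 uz (Pk e eP).
  by rewrite zk.
have PE : #|P| = #|X| + #|P'|.
  rewrite -(cardsID X) (setIidPr _); last first.
    by apply/subsetP => e; rewrite inE => /andP[].
  by congr (_ + _); apply: eq_card => e; rewrite !inE; case: (e \in P); rewrite ?andbT ?andbF.
have bX : b \in X by rewrite inE bP subD1set.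
have X0 : 0 < #|X| by rewrite card_gt0; apply/set0Pn; exists b.
have zZ : z \in Z by apply: PZ.
have [||||B [BP' B0 Bf]] := IH P' (Z :\ z).
- by lia.
- by move=> e; rewrite inE => /andP[/Pk].
- move=> e j; rewrite inE => /andP[eP ze] je; rewrite !inE PZ // andbT.
  by apply: contra ze => /eqP <-; apply: subD1set.
- move: ltP; rewrite (cardsD1 z Z) zZ PE mulnDr muln1 => h.
  by rewrite -(ltn_add2l m) (leq_trans h) // leq_add2r.
exists B; split => //; apply: subset_trans BP' _.
by apply/subsetP => e; rewrite inE => /andP[].
Qed.

(** * Homogeneous subfamilies *)

Definition part (V C : finType) (chi : V -> C) (I : {set C}) (e : {set V}) :
    {set V} :=
  [set v in e | chi v \in I].

(** The type of [e :&: e'] is its set of colours; for a rainbow edge [e] it determines which part of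
    [e] is shared. *)
Definition avoided (V C : finType) (chi : V -> C) (F : {set {set V}})
    (I : {set C}) : Prop :=
  forall e e', e \in F -> e' \in F -> e != e' -> chi @: (e :&: e') <> I.

Definition rainbow (V C : finType) (chi : V -> C) (e : {set V}) : Prop :=
  {in e &, injective chi} /\ chi @: e = setT.

Lemma part_mem (V C : finType) (chi : V -> C) I (e e' : {set V}) u :
  rainbow chi e -> rainbow chi e' -> part chi I e \subset e' -> u \in e' ->
  chi u \in I -> u \in part chi I e.
Proof.
move=> [_ efull] [e'inj _] sub ue' uI.
have /imsetP[w we cw] : chi u \in chi @: e by rewrite efull.
have wP : w \in part chi I e by rewrite inE we -cw.
by rewrite (e'inj u w) // (subsetP sub).
Qed.

(* Repeatedly delete the edges containing a non-kernel part of type I.  Among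
   the edges deleted at one step, at least 1/t share a vertex outside that part;
   they go to R I, where I is therefore never the type of an intersection. *)
Lemma split_family (V C : finType) t (chi : V -> C) (Al : {set {set C}})
    (F : {set {set V}}) :
  (forall e, e \in F -> rainbow chi e) ->
  exists (G : {set {set V}}) (R : {set C} -> {set {set V}}),
  [/\ G \subset F, forall I, R I \subset F,
      forall I, I \in Al -> avoided chi (R I) I,
      forall I e, I \in Al -> e \in G -> robust t G (part chi I e) &
      #|F| <= #|G| + t * \sum_(I in Al) #|R I|].
Proof.
have [N] := ubnP #|F|; elim: N F => // N IH F ltN rb.
have [/forall_inP good|] :=
  boolP [forall I in Al, [forall e in F, robust t F (part chi I e)]].
  exists F, (fun _ => set0); split => //.
  - by move=> I; apply: sub0set.
  - by move=> I _ e e'; rewrite inE.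
  - by move=> I e IA eF; have /forall_inP := good I IA; apply.
  - exact: leq_addr.
rewrite negb_forall_in => /exists_inP[I0 I0A].
rewrite negb_forall_in => /exists_inP[e0 e0F /robustPn[U Ut cov]].
set P := part chi I0 e0 in cov.
pose X := [set e in F | P \subset e].
have e0X : e0 \in X by rewrite inE e0F; apply/subsetP => v; rewrite inE => /andP[].
pose Xu u := [set e in X | u \in e].
have [||u uU Xcard] := @pigeonhole_cover _ _ X (U :\: P) Xu.
- apply/subsetP => e eX; move: (eX); rewrite inE => /andP[eF Pe].
  have [u /setIP[ue uU] uP] := cov e eF Pe; apply/bigcupP; exists u.
    by rewrite inE uP.
  by rewrite inE eX.
- by apply/set0Pn; exists e0.
have Xt : #|X| <= t * #|Xu u|.
  apply: leq_trans Xcard _; rewrite leq_mul2r (leq_trans _ Ut) ?orbT //.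
  by apply/subset_leq_card/subsetDl.
have FE : #|F| = #|X| + #|F :\: X|.
  rewrite -(cardsID X) (setIidPr _) //.
  by apply/subsetP => e; rewrite inE => /andP[].
have X0 : 0 < #|X| by rewrite card_gt0; apply/set0Pn; exists e0.
have [|e|G [R [GF RF Rav Grob Fcard]]] := IH (F :\: X).
- by lia.
- by rewrite inE => /andP[_ /rb].
pose R' I := if I == I0 then R I0 :|: Xu u else R I.
have XuF : Xu u \subset F.
  by apply/subsetP => e; rewrite !inE => /andP[/andP[]].
have FXF : F :\: X \subset F by apply: subsetDl.
exists G, R'; split => //.
- exact: subset_trans GF _.
- move=> I; rewrite /R'; case: eqP => _; last exact: subset_trans (RF _) _.
  by rewrite subUset XuF (subset_trans (RF _)).
- move=> I IA; rewrite /R'; case: eqP => [->|_]; last exact: Rav.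
  case/setDP: uU => uU uP.
  have uI0 e : e \in Xu u -> chi u \notin I0.
    rewrite !inE => /andP[/andP[eF Pe] ue]; apply: contra uP => uI.
    by apply: (part_mem (rb _ e0F) (rb _ eF)).
  (* An edge of [Xu u] has one vertex of each colour, so an intersection with it of type [I0] would
     contain [P]. Edges of [R I0] come from [F :\: X] and do not contain [P]. *)
  have cross e e' : e \in Xu u -> e' \in R I0 -> chi @: (e :&: e') <> I0.
    move=> eX /(subsetP (RF _)); rewrite !inE => /andP[]; case e'F: (e' \in F) => //=.
    move=> /negP nP _ eq; apply: nP.
    move: eX; rewrite !inE => /andP[/andP[eF Pe] ue].
    apply/subsetP => v vP; have ve := subsetP Pe v vP.
    have : chi v \in I0 by move: vP; rewrite inE => /andP[].
    rewrite -eq => /imsetP[w /setIP[we we'] cvw].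
    by have [einj _] := rb e eF; rewrite (einj v w).
  move=> e e' /setUP[eR|eX] /setUP[e'R|e'X] ee'.
  + exact: Rav.
  + by rewrite setIC; apply: cross.
  + exact: cross.
  + move=> eq; have /negP := uI0 e eX; apply; rewrite -eq; apply: imset_f.
    by move: eX e'X; rewrite !inE => /andP[_ ->] /andP[_ ->].
- have -> : \sum_(I in Al) #|R' I| = #|R I0 :|: Xu u| + \sum_(I in Al :\ I0) #|R I|.
    rewrite (big_setD1 I0) //= /R' eqxx; congr (_ + _); apply: eq_bigr => I.
    by rewrite !inE => /andP[/negbTE ->].
  rewrite cardsU disjoint_setI0 ?cards0 ?subn0.
    rewrite (big_setD1 I0) //= in Fcard; rewrite FE.
    apply: leq_trans (leq_add Xt Fcard) _; rewrite !mulnDr.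
    by rewrite addnCA leq_add2l addnA (addnC (t * #|Xu u|)).
  rewrite disjoints_subset; apply: subset_trans (RF _) _.
  by apply/subsetP => e; rewrite !inE => /andP[/negbTE ->].
Qed.

(** Induction on the number [k] of types that may still occur. After [split_family], either the
    remainder [G] keeps half of [F] and [J := Al] works, or some [R I] holds a fixed fraction of
    [F]; the latter avoids [I], so one type fewer is left. *)
Lemma homogeneous_subfamily t k : exists c : nat,
  forall (V C : finType) (chi : V -> C) (Al : {set {set C}}) (F : {set {set V}}),
  #|Al| <= k -> (forall e, e \in F -> rainbow chi e) ->
  (forall I, I \notin Al -> avoided chi F I) ->
  exists (G : {set {set V}}) (J : {set {set C}}),
  [/\ G \subset F, #|F| <= c * #|G|, forall I, I \notin J -> avoided chi G I &
      forall I e, I \in J -> e \in G -> robust t G (part chi I e)].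
Proof.
elim: k => [|k [c IH]].
  exists 1 => V C chi Al F; rewrite leqn0 cards_eq0 => /eqP-> rb av.
  by exists F, set0; split => // [|I e]; rewrite ?mul1n ?inE.
exists (2 + 2 * t * k.+1 * c) => V C chi Al F Ak rb av.
have [G [R [GF RF Rav Grob Fcard]]] := split_family t Al rb.
have [le2|gt2] := leqP #|F| (2 * #|G|).
  exists G, Al; split => //; first by apply: leq_trans le2 _; rewrite leq_mul2r leq_addr orbT.
  by move=> I /av IF e e' eG e'G; apply: IF; apply: (subsetP GF).
have [/exists_inP[I IA le]|] := boolP [exists I in Al, #|F| <= 2 * t * k.+1 * #|R I|].
  have [|||G' [J [G'R G'c Jav Jrob]]] := IH V C chi (Al :\ I) (R I).
  - by move: Ak; rewrite (cardsD1 I) IA.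
  - by move=> e /(subsetP (RF I)); apply: rb.
  - move=> I'; rewrite !inE negb_and negbK => /predU1P[->|/av av']; first exact: Rav.
    by move=> e e' eR e'R; apply: av'; apply: (subsetP (RF I)).
  exists G', J; split => //; first exact: subset_trans G'R (RF I).
  apply: leq_trans le _; rewrite mulnDl; apply: leq_trans (leq_addl _ _).
  by rewrite -(mulnA _ c) leq_mul2l G'c orbT.
rewrite negb_exists_in => /forall_inP small; exfalso.
have sum : 2 * t * k.+1 * (\sum_(I in Al) #|R I|) <= #|Al| * #|F|.
  rewrite big_distrr /= -sum_nat_const; apply: leq_sum => I /small.
  by rewrite -ltnNge => /ltnW.
have : #|Al| * #|F| <= k.+1 * #|F| by rewrite leq_mul2r Ak orbT.
nia.
Qed.

(** * Embedding 2-reducible trees *)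

Lemma subset_of_card (T : finType) (A : {set T}) m :
  m <= #|A| -> exists2 B : {set T}, B \subset A & #|B| = m.
Proof.
move=> mA; exists [set x in take m (enum A)].
  by apply/subsetP => x; rewrite inE => /mem_take; rewrite mem_enum.
rewrite cardsE (card_uniqP _) ?take_uniq ?enum_uniq //.
by rewrite size_takel // -cardE.
Qed.

Lemma degree1_edge (W : finType) (T : {set {set W}}) e e' w :
  degree T w == 1 -> e \in T -> e' \in T -> w \in e -> w \in e' -> e = e'.
Proof.
move=> /cards1P[e0 eq] eT e'T we we'.
have : e \in [set e0] by rewrite -eq inE eT.
have : e' \in [set e0] by rewrite -eq inE e'T.
by rewrite !inE => /eqP-> /eqP->.
Qed.

Lemma rtree_seq (W : finType) r (T : {set {set W}}) :
  is_rtree r T -> exists2 E : seq {set W}, E =i T & tree_seq E.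
Proof.
move=> [_ [E [_ ET tree]]]; exists E => // i iE.
have [a ai sub] := tree i iE; exists a => // w j ji wi wj.
apply: (subsetP sub); rewrite inE wi; apply/bigcupP.
by exists (Ordinal ji).
Qed.

(** Case [S = set0] of [skeleton_embed]: two vertices of degree 1 are private to each edge, and
    removing them leaves cores of size [r - 2]. *)
Lemma tree_embed (W V : finType) t r (T : {set {set W}}) (F B : {set {set V}}) :
  #|W| <= t -> #|W| <= #|V| -> is_rtree r T -> reducible2 T -> is_rgraph r F ->
  B != set0 -> (forall b, b \in B -> #|b| = r - 2) ->
  (forall b i, b \in B -> i \in b -> robust t B (b :\ i)) ->
  (forall b, b \in B -> robust t F b) ->
  embeddable T F.
Proof.
move=> Wt WV Ttree Tred Fr B0 Bk full rob.
have [E ET tree] := rtree_seq Ttree.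
have /forall_inP Tr := Ttree.1; move/forall_inP: Tred => Tred.
have /fin_all_exists[Y Yp] (e : {set W}) : exists Y : {set W}, e \in T ->
    [/\ Y \subset e, #|Y| = 2 & forall w, w \in Y -> degree T w == 1].
  case eT: (e \in T); last by exists set0.
  have [Y sub card] := subset_of_card (Tred e eT); exists Y => _; split => //.
    by apply: subset_trans sub _; apply/subsetP => w; rewrite inE => /andP[].
  by move=> w /(subsetP sub); rewrite inE => /andP[].
have Ycard e : e \in T -> #|e :\: (Y e :|: set0)| = r - 2.
  move=> eT; have [Ye Y2 _] := Yp e eT.
  by rewrite setU0 cardsD (setIidPr Ye) Y2 (eqP (Tr e eT)).
apply: (@skeleton_embed W V t (r - 2) r E T set0 Y F B set0) => //.
- by move=> e; rewrite ET.
- by move=> e /Tr/eqP.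
- move=> e e' w; rewrite !ET => eT e'T wY we'.
  have [Ye _ Y1] := Yp e eT.
  by apply: (degree1_edge (Y1 w wY)) => //; apply: (subsetP Ye).
- by move=> e; rewrite ET => /Ycard ->.
- by rewrite !cards0.
- by move=> b _; rewrite disjoint_sym disjoints_subset sub0set.
- move=> b e A' bB _; rewrite subset0 => /eqP-> _; rewrite set0U; exact: rob.
Qed.

(** An edge of [H] loses its vertex in [S] and one vertex of degree 1, which can be chosen outside
    [S] because two are available. An edge of [T] outside [H] loses two vertices of degree 1 and any
    further vertices of [S], so its core may be smaller than [r - 2]. *)
Lemma cross_cut_embed (W V : finType) t r (T H : {set {set W}}) (S : {set W})
    (F B : {set {set V}}) (A : {set V}) :
  #|W| <= t -> #|W| <= #|V| -> is_rtree r T -> reducible2 T -> is_rgraph r F ->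
  H \subset T -> cross_cut H S -> #|S| <= #|A| ->
  B != set0 -> (forall b, b \in B -> #|b| = r - 2) ->
  (forall b, b \in B -> [disjoint b & A]) ->
  (forall b i, b \in B -> i \in b -> robust t B (b :\ i)) ->
  (forall b a, b \in B -> a \in A -> robust t F (a |: b)) ->
  embeddable H F.
Proof.
move=> Wt WV Ttree Tred Fr HT /forall_inP HS SA B0 Bk BA full rob.
have [E ET tree] := rtree_seq Ttree.
have /forall_inP Tr := Ttree.1; move/forall_inP: Tred => Tred.
have /fin_all_exists[Y Yp] (e : {set W}) : exists Y : {set W}, e \in T ->
    [/\ Y \subset e, forall w, w \in Y -> degree T w == 1,
        #|e :\: (Y :|: S)| <= r - 2 &
        e \in H -> #|e :\: (Y :|: S)| = r - 2].
  case eT: (e \in T); last by exists set0.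
  have cardDU (Y : {set W}) : Y \subset e -> #|e :\: Y| = r - #|Y|.
    by move=> Ye; rewrite cardsD (setIidPr Ye) (eqP (Tr e eT)).
  case eH: (e \in H); last first.
    have [Y sub card] := subset_of_card (Tred e eT); exists Y => _; split => //.
    - by apply: subset_trans sub _; apply/subsetP => w; rewrite inE => /andP[].
    - by move=> w /(subsetP sub); rewrite inE => /andP[].
    rewrite -{1}card -cardDU; first by apply/subset_leq_card/setDS/subsetUl.
    by apply: subset_trans sub _; apply/subsetP => w; rewrite inE => /andP[].
  have /cards1P[s es] := HS e eH.
  have se : s \in e /\ s \in S by apply/setIP; rewrite es set11.
  have [w /setD1P[ws]] : exists w, w \in [set v in e | degree T v == 1] :\ s.
    apply/set0Pn; rewrite -card_gt0.
    by have := Tred e eT; rewrite (cardsD1 s); case: (s \in _) => //; lia.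
  rewrite inE => /andP[we w1].
  have wS : w \notin S.
    by apply: contra ws => wS; rewrite -in_set1 -es inE we.
  exists [set w] => _.
  have eq : #|e :\: ([set w] :|: S)| = r - 2.
    have -> : e :\: ([set w] :|: S) = e :\: [set w; s].
      apply/setP => v; rewrite !inE; case ve: (v \in e); rewrite ?andbF // !andbT.
      by congr (~~ (_ || _)); rewrite -in_set1 -es inE ve.
    by rewrite cardDU ?cards2 ?ws // subUset !sub1set we; case: se.
  split; rewrite ?eq ?sub1set //; by move=> v /set1P->.
apply: (@skeleton_embed W V t (r - 2) r E H S Y F B A) => //.
- by move=> e /(subsetP HT); rewrite ET.
- by move=> e /(subsetP HT)/Tr/eqP.
- move=> e e' w; rewrite !ET => eT e'T wY we'.
  have [Ye Y1 _ _] := Yp e eT.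
  by apply: (degree1_edge (Y1 w wY)) => //; apply: (subsetP Ye).
- by move=> e; rewrite ET => /Yp[].
- by move=> e eH; have [_ _ _ /(_ eH)] := Yp e (subsetP HT e eH).
- move=> b e A' bB eH /subsetP A'A; rewrite (eqP (HS e eH)) => /eqP/cards1P[a eqA].
  by rewrite eqA; apply: rob => //; apply: A'A; rewrite eqA set11.
Qed.

(** * Colourings with many rainbow edges *)

(** Averaging over all colourings: a given edge is rainbow in at least a fraction [1 / r ^ r] of
    them. *)
Lemma rainbow_colouring (V : finType) r (F : {set {set V}}) :
  0 < r -> is_rgraph r F -> exists chi : V -> 'I_r,
    #|F| <= r ^ r * #|[set e in F | chi @: e == setT]|.
Proof.
move=> r0 /forall_inP Fr.
suff [chi le] : exists chi : {ffun V -> 'I_r},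
  #|F| <= r ^ r * #|[set e in F | chi @: e == setT]| by exists chi.
apply/existsP; apply: contraT => /existsPn small.
have cV : #|{ffun V -> 'I_r}| = r ^ #|V| by rewrite card_ffun card_ord.
have cR : #|{ffun 'I_r -> 'I_r}| = r ^ r by rewrite card_ffun card_ord.
have key e : e \in F ->
    r ^ #|V| <= r ^ r * #|[set chi : {ffun V -> 'I_r} | chi @: e == setT]|.
  move=> eF; have card_e : #|e| = r by apply/eqP/Fr.
  have [v0 v0e] : exists v, v \in e by apply/set0Pn; rewrite -card_gt0 card_e.
  pose b v := cast_ord card_e (enum_rank_in v0e v).
  pose b' (i : 'I_r) := enum_val (cast_ord (esym card_e) i).
  have bK v : v \in e -> b' (b v) = v.
    by move=> ve; rewrite /b' /b cast_ordK enum_rankK_in.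
  have b'e i : b' i \in e by apply: enum_valP.
  have b'K i : b (b' i) = i by rewrite /b /b' enum_valK_in cast_ordKV.
  (* [phi] makes [e] rainbow by overwriting the colours on [e] with a fixed bijection; the first
     component records the old colours, which take at most [r ^ r] values. *)
  pose phi (chi : {ffun V -> 'I_r}) : {ffun 'I_r -> 'I_r} * {ffun V -> 'I_r} :=
    ([ffun i : 'I_r => chi (b' i)], [ffun v => if v \in e then b v else chi v]).
  have phi_inj : injective phi.
    move=> chi1 chi2 [/ffunP eq1 /ffunP eq2]; apply/ffunP => v.
    have [ve|nve] := boolP (v \in e); last first.
      by have := eq2 v; rewrite !ffunE (negbTE nve).
    by have := eq1 (b v); rewrite !ffunE bK.
  rewrite -cV -(cardsT {ffun V -> 'I_r}) -(card_imset setT phi_inj) -cR -(cardsT {ffun 'I_r -> 'I_r}) -cardsX.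
  apply/subset_leq_card/subsetP => _ /imsetP[chi _ ->].
  rewrite !inE /=; apply/eqP/setP => i; rewrite inE; apply/imsetP.
  by exists (b' i); rewrite ?b'e // ffunE b'e b'K.
have count : \sum_(chi : {ffun V -> 'I_r}) #|[set e in F | chi @: e == setT]|
    = \sum_(e in F) #|[set chi : {ffun V -> 'I_r} | chi @: e == setT]|.
  have := double_count setT F (fun (chi : {ffun V -> 'I_r}) e => chi @: e == setT).
  under eq_bigl do rewrite inE; move=> ->; apply: eq_bigr => e _.
  by apply: eq_card => chi; rewrite !inE.
have le1 : #|F| * r ^ #|V| <= r ^ r * \sum_(chi : {ffun V -> 'I_r})
    #|[set e in F | chi @: e == setT]|.
  rewrite count -sum_nat_const big_distrr /=; exact: leq_sum.
have le2 : r ^ r * (\sum_(chi : {ffun V -> 'I_r})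
    #|[set e in F | chi @: e == setT]|) < #|F| * r ^ #|V|.
  apply: (@leq_trans (\sum_(chi : {ffun V -> 'I_r}) #|F|)); last first.
    by rewrite sum_nat_const cV mulnC.
  apply: (@leq_trans (\sum_(chi : {ffun V -> 'I_r})
      (r ^ r * #|[set e in F | chi @: e == setT]| + 1))).
    rewrite big_split /= sum_nat_const muln1 cV -big_distrr /= -addn1 leq_add2l.
    by rewrite expn_gt0 r0.
  by apply: leq_sum => chi _; rewrite addn1 ltnNge small.
by move: (leq_ltn_trans le1 le2); rewrite ltnn.
Qed.

(** * Centers *)

Definition centered (V : finType) t r (F : {set {set V}}) (e : {set V}) (x : V) :
    bool :=
  [&& x \in e, [forall y in e :\ x, robust t F (e :\ y)] &
      [forall B : {set V}, (B \subset e :\ x) && (#|B| == r - 2) ==>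
         ~~ robust t F B]].

Lemma card_part (V C : finType) (chi : V -> C) (I : {set C}) (e : {set V}) :
  rainbow chi e -> #|part chi I e| = #|I|.
Proof.
move=> [einj efull]; have eqI : chi @: part chi I e = I.
  apply/setP => i; apply/imsetP/idP => [[v] | iI].
    by rewrite inE => /andP[_ vI] ->.
  have /imsetP[v ve ci] : i \in chi @: e by rewrite efull.
  by exists v; rewrite // inE ve -ci.
rewrite -{2}eqI card_in_imset // => v w; rewrite !inE => /andP[ve _] /andP[we _].
exact: einj.
Qed.

(** The parts of type [I] form a full family. To replace the vertex of colour [i] in such a part,
    use a kernel of a type [M] with [M :&: I = I :\ i]: it fixes the other vertices of the part and
    frees this one. *)
Lemma full_parts_embed (W V : finType) t r (T : {set {set W}})
    (F G : {set {set V}}) (chi : V -> 'I_r) (J : {set {set 'I_r}})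
    (I : {set 'I_r}) :
  #|W| <= t -> #|W| <= #|V| -> is_rtree r T -> reducible2 T -> is_rgraph r F ->
  G != set0 -> (forall e, e \in G -> rainbow chi e) ->
  (forall M e, M \in J -> e \in G -> robust t G (part chi M e)) ->
  #|I| = r - 2 -> (forall e, e \in G -> robust t F (part chi I e)) ->
  (forall i, i \in I -> exists2 M, M \in J & M :&: I = I :\ i) ->
  embeddable T F.
Proof.
move=> Wt WV Ttree Tred Fr /set0Pn[e0 e0G] rb Jrob Ir Irob cov.
apply: (@tree_embed W V t r T F (part chi I @: G)) => //.
- by apply/set0Pn; exists (part chi I e0); apply: imset_f.
- by move=> _ /imsetP[e eG ->]; rewrite (card_part _ (rb e eG)).
- move=> _ v /imsetP[e eG ->]; rewrite inE => /andP[ve vI].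
  have [M MJ MI] := cov _ vI; have [einj _] := rb e eG.
  have memMI w : (chi w \in M) && (chi w \in I) = (chi w != chi v) && (chi w \in I).
    by rewrite -in_setI MI !inE.
  apply/robustP => U /(robustP _ _ _ (Jrob M e MJ eG))[e' [e'G sub1 sub2]].
  exists (part chi I e'); split; first exact: imset_f.
    apply/subsetP => w; rewrite !inE => /and3P[wv we wI].
    have cwv : chi w != chi v by apply: contra wv => /eqP/einj->.
    have /andP[wM _] : (chi w \in M) && (chi w \in I) by rewrite memMI cwv.
    by rewrite wI andbT; apply: (subsetP sub1); rewrite inE we.
  apply/subsetP => w; rewrite !inE => /andP[/andP[we' wI] wU].
  have : w \in part chi M e by apply: (subsetP sub2); rewrite inE we'.
  rewrite inE => /andP[we wM]; rewrite we wI !andbT.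
  have : (chi w \in M) && (chi w \in I) by rewrite wM.
  by rewrite memMI => /andP[+ _]; apply: contra => /eqP->.
- by move=> _ /imsetP[e eG ->]; apply: Irob.
Qed.

(** The uncentered edges are thinned out three times, each at the cost of a constant factor: to
    rainbow edges, to edges with the same set of kernel types, and to a homogeneous family [G]. More
    than ['C(#|V|, r - 2)] edges in [G] would then produce [T] in [F]. *)
Lemma few_uncentered t r : 2 < r -> exists c : nat,
  forall (W V : finType) (T : {set {set W}}) (F : {set {set V}}),
  #|W| <= t -> #|W| <= #|V| -> is_rtree r T -> reducible2 T -> is_rgraph r F ->
  ~ embeddable T F ->
  #|[set e in F | ~~ [exists x, centered t r F e x]]| <= c * 'C(#|V|, r - 2).
Proof.
move=> r3; have [c0 hom] := homogeneous_subfamily t (2 ^ r).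
exists (r ^ r * (#|{set {set 'I_r}}| * c0)) => W V T F Wt WV Ttree Tred Fr Tfree.
set Fb := [set e in F | _].
have FbF : Fb \subset F by apply/subsetP => e; rewrite inE => /andP[].
have Fbr : is_rgraph r Fb.
  apply/forall_inP => e /(subsetP FbF); exact: (forall_inP Fr).
have [chi le1] := rainbow_colouring (ltn_trans (isT : 0 < 2) r3) Fbr.
set F1 := [set e in Fb | _] in le1.
have F1rb e : e \in F1 -> rainbow chi e.
  rewrite inE => /andP[eb /eqP full]; split=> //; apply/imset_injP.
  by rewrite full cardsT card_ord eq_sym; apply: (forall_inP Fbr).
have [F10|F1n0] := eqVneq F1 set0.
  by move: le1; rewrite F10 cards0 muln0 leqn0 => /eqP->.
pose kind e := [set I | robust t F (part chi I e)].
have [||K _ le2] := @pigeonhole_cover _ _ F1 setT (fun K => [set e in F1 | kind e == K]).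
- apply/subsetP => e eF1; apply/bigcupP; exists (kind e); first by rewrite inE.
  by rewrite inE eF1 eqxx.
- by [].
set F2 := [set e in F1 | _] in le2.
have F2F1 : F2 \subset F1 by apply/subsetP => e; rewrite inE => /andP[].
have [|||G [J [GF2 le3 Jav Jrob]]] := hom V 'I_r chi setT F2.
- by rewrite -powersetT card_powerset cardsT card_ord.
- by move=> e /(subsetP F2F1)/F1rb.
- by move=> I; rewrite inE.
rewrite cardsT in le2.
apply: leq_trans le1 _; rewrite -mulnA leq_mul2l; apply/orP; right.
apply: leq_trans le2 _; rewrite -mulnA leq_mul2l; apply/orP; right.
apply: leq_trans le3 _; rewrite leq_mul2l; apply/orP; right.
rewrite leqNgt; apply/negP => Gbig.
have GF1 := subset_trans GF2 F2F1.
have rb e : e \in G -> rainbow chi e by move/(subsetP GF1)/F1rb.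
have GF : G \subset F.
  by apply: subset_trans GF1 (subset_trans _ FbF); apply/subsetP => e; rewrite inE => /andP[].
have Gr e : e \in G -> #|e| = r by move/(subsetP GF) => eF; apply/eqP/(forall_inP Fr).
have G0 : G != set0 by rewrite -card_gt0 (leq_ltn_trans _ Gbig).
have JrobF (I : {set 'I_r}) e : I \in J -> e \in G -> robust t F (part chi I e).
  by move=> IJ eG; apply: (robust_mono GF); apply: Jrob.
have embed (I : {set 'I_r}) : #|I| = r - 2 -> (forall e, e \in G -> robust t F (part chi I e)) ->
   (forall i, i \in I -> exists2 M, M \in J & M :&: I = I :\ i) -> False.
  by move=> *; apply: Tfree; apply: (@full_parts_embed W V t r T F G chi J I).
(* [G] has more edges than there are [(r-2)]-sets, so two of its edges share their part of type [I].
   The type of their intersection is not avoided, hence lies in [J], and it is proper because the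
   edges differ. *)
have cover (I : {set 'I_r}) : #|I| = r - 2 -> exists M : {set 'I_r}, [/\ M \in J, I \subset M & M != setT].
  move=> Ir; have /dinjectivePn[e eG [e' e'G ee']] : ~~ dinjectiveb (part chi I) (mem G).
    apply: contraL Gbig => /dinjectiveP inj; rewrite -leqNgt -(card_in_imset inj).
    rewrite -(card_draws V (r - 2)); apply/subset_leq_card/subsetP => _ /imsetP[e eG ->].
    by rewrite inE (card_part _ (rb e eG)) Ir.
  have [nee' e'G'] : e != e' /\ e' \in G.
    by move: e'G; rewrite !inE eq_sym => /andP[].
  exists (chi @: (e :&: e')); split.
  - by apply: contraT => /Jav/(_ e e' eG e'G' nee').
  - apply/subsetP => i iI; have [_ efull] := rb e eG.
    have /imsetP[v ve ci] : i \in chi @: e by rewrite efull.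
    rewrite ci; apply: imset_f; rewrite inE ve /=.
    have : v \in part chi I e by rewrite inE ve -ci.
    by rewrite ee' inE => /andP[].
  - apply: contra nee' => /eqP full.
    have le : r <= #|e :&: e'|.
      by rewrite -{1}(card_ord r) -cardsT -full leq_imset_card.
    have : e :&: e' == e by rewrite eqEcard subsetIl Gr.
    have : e :&: e' == e' by rewrite eqEcard subsetIr Gr.
    by move=> /eqP-> /eqP->.
(* A proper type containing all colours but [c1] and [c2] misses [c1], [c2] or both; the hypotheses
   exclude the first two cases. *)
have cover2 c1 c2 : c1 != c2 -> ~: [set c1] \notin J -> ~: [set c2] \notin J ->
    ~: [set c1; c2] \in J.
  move=> c12 c1J c2J.
  have [|M [MJ sub MT]] := cover (~: [set c1; c2]).
    by rewrite cardsCs setCK card_ord cards2 c12.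
  have memM i : i != c1 -> i != c2 -> i \in M.
    by move=> i1 i2; apply: (subsetP sub); rewrite !inE negb_or i1.
  have [c1M|c1M] := boolP (c1 \in M); have [c2M|c2M] := boolP (c2 \in M).
  - case/eqP: MT; apply/setP => i; rewrite inE.
    have [-> //|i1] := eqVneq i c1; have [-> //|i2] := eqVneq i c2.
    exact: memM.
  - case/negP: c2J; suff <- : M = ~: [set c2] by [].
    apply/setP => i; rewrite !inE.
    have [->|i2] := eqVneq i c2; first exact/negbTE.
    by have [-> //|i1] := eqVneq i c1; rewrite memM.
  - case/negP: c1J; suff <- : M = ~: [set c1] by [].
    apply/setP => i; rewrite !inE.
    have [->|i1] := eqVneq i c1; first exact/negbTE.
    by have [-> //|i2] := eqVneq i c2; rewrite memM.
  suff <- : M = ~: [set c1; c2] by [].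
  apply/setP => i; rewrite !inE negb_or.
  have [->|i1] := eqVneq i c1; first exact/negbTE.
  by have [->|i2] := eqVneq i c2; [apply/negbTE | rewrite memM].
(* With two such colours, [I = ~: [set c1; c2]] is a kernel type, and for each [i] in [I] either [~:
   [set i]] or [~: [set c1; i]] lies in [J]; both meet [I] in [I :\ i]. *)
have [/existsP[c1 /existsP[c2 /and3P[c12 c1J c2J]]]|one] :=
  boolP [exists c1, exists c2, [&& c1 != c2, ~: [set c1] \notin J & ~: [set c2] \notin J]].
  apply: (embed (~: [set c1; c2])).
  - by rewrite cardsCs setCK card_ord cards2 c12.
  - by move=> e eG; apply: JrobF => //; apply: cover2.
  move=> i; rewrite !inE negb_or => /andP[i1 i2].
  have [iJ|iJ] := boolP (~: [set i] \in J).
    exists (~: [set i]) => //; apply/setP => j; rewrite !inE.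
    by case: (j == i).
  exists (~: [set c1; i]); first by apply: cover2 => //; rewrite eq_sym.
  by apply/setP => j; rewrite !inE !negb_or; case: (j == c1); case: (j == i).
have [c cP] : exists c, forall i, i != c -> ~: [set i] \in J.
  have [c cJ|none] := pickP (fun c => ~: [set c] \notin J); last first.
    have r0 : 0 < r by lia.
    by exists (Ordinal r0) => i _; have /negbT := none i; rewrite negbK.
  exists c => i ic; apply: contraNT one => iJ.
  by apply/existsP; exists c; apply/existsP; exists i; rewrite eq_sym ic cJ.
(* Now every [~: [set i]] with [i != c] is in [J], so the vertex [x] of colour [c] in [e0] satisfies
   the first condition on a center. As [e0] has no center, some [(r-2)]-set [B] in [e0 :\ x] is a
   kernel; its type is a kernel type on all of [G], and [embed] applies to it. *)
have [e0 e0G] := set0Pn _ G0.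
have [e0inj e0full] := rb e0 e0G.
have /imsetP[x xe0 cx] : c \in chi @: e0 by rewrite e0full inE.
have e0Fb : e0 \in Fb.
  by move: (subsetP GF1 e0 e0G); rewrite inE => /andP[].
move: e0Fb; rewrite inE => /andP[_ /existsPn/(_ x)]; rewrite /centered xe0 /=.
have -> : [forall y in e0 :\ x, robust t F (e0 :\ y)].
  apply/forall_inP => y /setD1P[yx ye0].
  have -> : e0 :\ y = part chi (~: [set chi y]) e0.
    apply/setP => v; rewrite !inE andbC; case ve: (v \in e0) => //=.
    by rewrite (inj_in_eq e0inj).
  apply: JrobF => //; apply: cP; rewrite cx; apply: contra yx => /eqP/e0inj->//.
rewrite negb_forall => /existsP[B]; rewrite negb_imply negbK => /andP[/andP[Bx /eqP Br] Brob].
have Be0 : B \subset e0 by apply: subset_trans Bx (subsetDl _ _).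
have BE : B = part chi (chi @: B) e0.
  apply/setP => v; rewrite inE; apply/idP/andP => [vB|[ve /imsetP[w wB]]].
    by rewrite imset_f // (subsetP Be0).
  by move/e0inj => -> //; apply: (subsetP Be0).
apply: (embed (chi @: B)).
- rewrite card_in_imset // => v w vB wB; apply: e0inj; exact: (subsetP Be0).
- move=> e eG; have kE : kind e = kind e0.
    have := subsetP GF2 e eG; have := subsetP GF2 e0 e0G.
    by rewrite !inE => /andP[_ /eqP->] /andP[_ /eqP->].
  have : chi @: B \in kind e by rewrite kE inE -BE.
  by rewrite inE.
- move=> i iB; exists (~: [set i]); last first.
    by apply/setP => j; rewrite !inE.
  apply: cP; case/imsetP: iB => v vB ->; rewrite cx.
  have /setD1P[vx ve] := subsetP Bx v vB.
  by apply: contra vx => /eqP/e0inj->.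
Qed.

(** * Shadows and labellings *)

Definition link (V : finType) (v : V) (G : {set {set V}}) : {set {set V}} :=
  [set B : {set V} | (v \notin B) && (v |: B \in G)].

Lemma card_link (V : finType) (v : V) (G : {set {set V}}) :
  #|link v G| = #|[set D in G | v \in D]|.
Proof.
have <- : (fun B : {set V} => v |: B) @: link v G = [set D in G | v \in D].
  apply/setP => D; apply/imsetP/idP => [[B] | ].
    by rewrite inE => /andP[_ BG] ->; rewrite inE BG setU11.
  rewrite inE => /andP[DG vD]; exists (D :\ v); last by rewrite setD1K.
  by rewrite inE setD1K // DG !inE eqxx.
rewrite card_in_imset // => B B'; rewrite !inE => /andP[vB _] /andP[vB' _] eq.
by rewrite -(setU1K vB) eq setU1K.
Qed.

Lemma sum_card_sub (V : finType) (X : {set V}) (G : {set {set V}}) :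
  \sum_(v in X) #|[set D in G | v \in D]| = \sum_(D in G) #|X :&: D|.
Proof.
rewrite (double_count X G (fun v D => v \in D)); apply: eq_bigr => D _.
by apply: eq_card => v; rewrite !inE.
Qed.

Lemma sum_card_link (V : finType) k (G : {set {set V}}) :
  (forall D, D \in G -> #|D| = k) -> \sum_(v : V) #|link v G| = #|G| * k.
Proof.
move=> Gk; under eq_bigr do rewrite card_link.
rewrite -sum_nat_const.
have := sum_card_sub [set: V] G.
under eq_bigl do rewrite inE.
by move=> ->; apply: eq_bigr => D /Gk; rewrite setTI.
Qed.

(* This is the Kruskal-Katona type bound |G| <= |P|^((k+1)/k), in a form that
   avoids fractional exponents.  A link either satisfies the induction hypothesis
   or its shadow is so large that |link v G| <= |P| suffices. *)
Lemma shadow_bound (V : finType) M k (G P : {set {set V}}) :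
  (forall D, D \in G -> #|D| = k.+1) -> (forall B, B \in P -> #|B| = k) ->
  (forall D v, D \in G -> v \in D -> D :\ v \in P) ->
  #|P| < M ^ k -> #|G| <= M * #|P|.
Proof.
elim: k G P => [|k IH] G P Gk Pk GP ltP.
  have P0 : P = set0 by apply/eqP; rewrite -cards_eq0 -leqn0 -ltnS.
  suff -> : G = set0 by rewrite cards0.
  apply/setP => D; rewrite inE; apply/negP => DG.
  have /card_gt0P[v vD] : 0 < #|D| by rewrite Gk.
  by have := GP D v DG vD; rewrite P0 inE.
have le v : #|link v G| <= M * #|link v P|.
  have [lt|ge] := ltnP #|link v P| (M ^ k).
    apply: IH => //.
    - by move=> D; rewrite inE => /andP[vD /Gk]; rewrite cardsU1 vD => -[].
    - by move=> D; rewrite inE => /andP[vD /Pk]; rewrite cardsU1 vD => -[].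
    - move=> D u; rewrite !inE => /andP[vD DG] uD.
      have uv : u != v by apply: contraNneq vD => <-.
      have -> : v |: D :\ u = (v |: D) :\ u.
        apply/setP => w; rewrite !inE; case: (eqVneq w v) => [->|] //=.
        by rewrite eq_sym uv.
      by rewrite negb_and vD orbT GP // inE uD orbT.
  apply: (@leq_trans #|P|).
    apply/subset_leq_card/subsetP => D; rewrite inE => /andP[vD DG].
    by rewrite -(setU1K vD) GP // setU11.
  by apply: leq_trans (ltnW ltP) _; rewrite expnS leq_mul2l ge orbT.
have : \sum_(v : V) #|link v G| <= \sum_(v : V) M * #|link v P|.
  by apply: leq_sum => v _; apply: le.
rewrite -big_distrr /= (sum_card_link Gk) (sum_card_link Pk) => le'.
rewrite -(leq_pmul2r (ltn0Sn k.+1)); apply: leq_trans le' _.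
by rewrite mulnA leq_mul2l leqnSn orbT.
Qed.

Definition ksub (V : finType) (X : {set V}) k : {set {set V}} :=
  [set D : {set V} | (D \subset X) && (#|D| == k)].

(* Isoperimetry in the Johnson graph.  The label l is the majority label of the
   link of the vertex z lying in the fewest unlabelled sets; a labelled D not
   containing z then has label l unless some z + (D - y) does not. *)
Lemma majority_label (V : finType) (L : eqType) (l0 : L) k (X : {set V})
    (lam : {set V} -> option L) :
  (forall (D D' : {set V}) a b, D \in ksub X k.+1 -> D' \in ksub X k.+1 ->
     #|D :&: D'| = k -> lam D = Some a -> lam D' = Some b -> a = b) ->
  exists l, #|[set D in ksub X k.+1 | lam D != Some l]| <=
            k.+1 * #|[set D in ksub X k.+1 | lam D == None]|.
Proof.
elim: k X lam => [|k IH] X lam compat.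
  have [/exists_inP[D DX]|none] := boolP [exists D in ksub X 1, lam D != None].
    case lamD: (lam D) => [l|] // _; exists l; rewrite mul1n.
    apply/subset_leq_card/subsetP => D'; rewrite !inE => /andP[D'X nl].
    rewrite D'X /=; case lamD': (lam D') => [b|] //; exfalso.
    have [eqD|neD] := eqVneq D' D; first by move: nl; rewrite eqD lamD eqxx.
    have D'k : D' \in ksub X 1 by rewrite inE.
    move: nl; rewrite lamD' => /eqP; apply; congr Some; symmetry.
    apply: (compat D D') => //; apply/eqP; rewrite cards_eq0 setI_eq0.
    move: DX D'X neD; rewrite inE => /andP[_ /cards1P[v ->]] /andP[_ /cards1P[w ->]].
    by rewrite disjoints1 inE; apply: contra => /eqP->.
  exists l0; rewrite mul1n; apply/subset_leq_card/subsetP => D.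
  rewrite !inE => /andP[DX _]; rewrite DX /=.
  have := exists_inPn none D; rewrite inE DX => /(_ isT); by rewrite negbK.
set Irr := [set D in _ | lam D == None].
have IrrP D : D \in Irr -> D \subset X /\ #|D| = k.+2.
  by rewrite !inE => /andP[/andP[-> /eqP->]].
have [X0|/set0Pn[z0 z0X]] := eqVneq X set0.
  exists l0; suff -> : [set D in ksub X k.+2 | lam D != Some l0] = set0.
    by rewrite cards0.
  apply/setP => D; rewrite !inE X0 subset0.
  by apply/negP => /andP[/andP[/eqP->]]; rewrite cards0.
have [z zX zmin] := arg_minnP (fun z => #|[set D in Irr | z \in D]|) z0X.
have {}zX : z \in X := zX.
have zle : #|X| * #|[set D in Irr | z \in D]| <= #|Irr| * k.+2.
  rewrite -!sum_nat_const.
  apply: (@leq_trans (\sum_(v in X) #|[set D in Irr | v \in D]|)); first exact: leq_sum.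
  rewrite sum_card_sub; apply: leq_sum => D /IrrP[_ <-].
  exact/subset_leq_card/subsetIr.
have notz D : D \in ksub (X :\ z) k.+1 -> z \notin D.
  by rewrite inE subsetD1 => /andP[/andP[]].
have zU D : D \in ksub (X :\ z) k.+1 -> z |: D \in ksub X k.+2.
  move=> Dk; have zD := notz D Dk; move: Dk; rewrite !inE subsetD1 cardsU1 zD.
  by move=> /andP[/andP[DX _] /eqP->]; rewrite subUset sub1set zX DX eqxx.
have [|l lP] := IH (X :\ z) (fun D => lam (z |: D)).
  move=> D D' a b Dk D'k DD'; apply: compat; try exact: zU.
  by rewrite -setUIr cardsU1 DD' inE (negbTE (notz D Dk)).
set Wz := [set D in _ | lam (z |: D) != Some l] in lP.
have irrz : #|[set D in ksub (X :\ z) k.+1 | lam (z |: D) == None]| <=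
            #|[set D in Irr | z \in D]|.
  rewrite -card_link; apply/subset_leq_card/subsetP => D; rewrite !inE.
  move=> /andP[Dk lD]; have Dk' : D \in ksub (X :\ z) k.+1 by rewrite inE.
  by rewrite notz //= lD; have := zU D Dk'; rewrite inE => ->.
exists l; set Wl := [set D in _ | lam D != Some l].
pose N := [set D in Wl | (z \notin D) && (lam D != None)].
have NP D : D \in N -> [/\ D \subset X, #|D| = k.+2, z \notin D & lam D != Some l].
  by rewrite !inE => /andP[/andP[/andP[-> /eqP->] ->] /andP[->]].
(* If [v |: B] is in [N], then [B] is in [Wz]: otherwise [z |: B] has label [l], and since it meets
   [v |: B] in [B], compatibility would give [v |: B] the label [l] too. *)
have Nle : #|N| * k.+2 <= \sum_(B in Wz) #|X :\: (z |: B)|.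
  have <- : \sum_(v in V) #|link v N| = #|N| * k.+2.
    by apply: sum_card_link => D /NP[].
  apply: (@leq_trans (\sum_(v : V) #|[set B in Wz | v \in X :\: (z |: B)]|)).
    apply: leq_sum => v _; apply/subset_leq_card/subsetP => B.
    rewrite inE => /andP[vB vBN]; have [sub card zvB nl] := NP _ vBN.
    move: sub card zvB; rewrite subUset sub1set cardsU1 vB !inE negb_or.
    move=> /andP[vX BX] /eqP; rewrite add1n eqSS => /eqP cB /andP[zv zB].
    have Bk : B \in ksub (X :\ z) k.+1 by rewrite inE subsetD1 BX zB cB /=.
    rewrite subsetD1 BX zB cB eqxx vX (negbTE vB) orbF (eq_sym v z) zv /= andbT.
    apply/negP => /eqP lz; case lv: (lam (v |: B)) nl => [b|]; last first.
      by move: vBN; rewrite !inE lv !andbF.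
    have vBk : v |: B \in ksub X k.+2.
      by move: vBN; rewrite inE => /andP[]; rewrite inE => /andP[].
    move=> /eqP; apply; congr Some; symmetry; apply: (compat (z |: B) (v |: B)) => //.
      exact: zU.
    have -> : (z |: B) :&: (v |: B) = B; last exact: cB.
    apply/setP => w; rewrite !inE; case: (eqVneq w z) => [->|] /=.
      by rewrite (negbTE zB) (negbTE zv).
    by case: (w \in B); rewrite ?orbT ?andbF.
  have := double_count setT Wz (fun v B => v \in X :\: (z |: B)).
  under eq_bigl do rewrite inE; move=> ->; apply: leq_sum => B _.
  by apply/subset_leq_card/subsetP => v; rewrite inE => /andP[].
have WlE : #|Wl| <= #|Wz| + (#|N| + #|Irr|).
  have sub : Wl \subset (fun B : {set V} => z |: B) @: Wz :|: (N :|: Irr).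
    apply/subsetP => D DWl; rewrite inE; have [zD|zD] := boolP (z \in D).
      apply/orP; left; apply/imsetP; exists (D :\ z); last by rewrite setD1K.
      move: DWl; rewrite !inE setD1K // => /andP[/andP[DX Dk] ->].
      rewrite setSD // andbT /=; move: Dk; by rewrite (cardsD1 z) zD.
    apply/orP; right; rewrite inE.
    have [lD|lD] := eqVneq (lam D) None; apply/orP; [right|left].
      by move: DWl; rewrite !inE => /andP[-> _]; rewrite lD eqxx.
    by rewrite inE DWl zD lD.
  apply: leq_trans (subset_leq_card sub) _.
  apply: leq_trans (leq_card_setU _ _) _.
  by rewrite leq_add ?leq_imset_card // leq_card_setU.
(* With [Nle] this yields [k.+2 * (#|Wz| + #|N|) <= #|Wz| * #|X|]. The induction hypothesis and the
   choice of [z] bound the right side by [k.+1 * k.+2 * #|Irr|], and the last [k.+2 * #|Irr|] comes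
   from [Irr] itself. *)
have sumX : \sum_(B in Wz) #|X :\: (z |: B)| + #|Wz| * k.+2 = #|Wz| * #|X|.
  rewrite -!sum_nat_const -big_split /=; apply: eq_bigr => B.
  rewrite inE => /andP[/zU]; rewrite inE => /andP[sub /eqP <-] _.
  by rewrite -(cardsID (z |: B) X) (setIidPr sub) addnC.
have : #|Wz| * #|X| <= k.+1 * (#|Irr| * k.+2).
  apply: (@leq_trans (k.+1 * #|[set D in Irr | z \in D]| * #|X|)).
    by rewrite leq_mul2r (leq_trans lP) ?orbT // leq_mul2l irrz orbT.
  by rewrite -mulnA leq_mul2l mulnC zle orbT.
move: Nle WlE sumX; move: (\sum_(B in Wz) _) #|N| #|Wl| #|Wz| #|Irr| #|X|.
move=> a b c d e f h1 h2 h3 h4; rewrite -(leq_pmul2l (ltn0Sn k.+1)).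
apply: leq_trans (_ : k.+2 * (d + (b + e)) <= _); first by rewrite leq_mul2l h2 orbT.
have -> : k.+2 * (k.+2 * e) = k.+1 * (e * k.+2) + k.+2 * e by lia.
rewrite !mulnDr addnA leq_add2r; apply: leq_trans h4.
by rewrite -h3 addnC mulnC leq_add // mulnC.
Qed.

(** * Counting *)

Lemma bin_leq_exp n m : 'C(n, m) <= n ^ m.
Proof.
have le : n ^_ m <= n ^ m.
  by elim: m => // m IH; rewrite ffactnSr expnSr leq_mul ?leq_subr.
apply: leq_trans le; rewrite -bin_ffact leq_pmulr ?fact_gt0 //.
Qed.

Lemma card_ksub (V : finType) k : #|ksub [set: V] k| = 'C(#|V|, k).
Proof. by rewrite -card_draws; apply: eq_card => D; rewrite !inE subsetT. Qed.

(* Only meaningful when B is not itself a kernel, see card_apex. *)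
Definition apex (V : finType) t (F : {set {set V}}) (B : {set V}) : {set V} :=
  [set x | (x \notin B) && robust t F (x |: B)].

(** Let [U] meet every edge through [B] outside [B]. An edge through [x |: B] that avoids [U]
    outside [x |: B] can be hit only at [x], so every apex belongs to [U]. *)
Lemma card_apex (V : finType) t (F : {set {set V}}) (B : {set V}) :
  ~~ robust t F B -> #|apex t F B| <= t.
Proof.
move=> /robustPn[U Ut cov]; apply: leq_trans (Ut); apply/subset_leq_card/subsetP => x.
rewrite inE => /andP[xB /robustP/(_ U Ut)[e [eF sub1 sub2]]].
move: sub1; rewrite subUset sub1set => /andP[xe Be].
have [u uI uB] := cov e eF Be; have := subsetP sub2 u uI; rewrite !inE (negbTE uB) orbF.
by move=> /eqP <-; case/setIP: uI.
Qed.

(** [pick] fixes one center for each centered edge, which is thus recorded once, as its center [x]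
    and the remaining set [D]. *)
Definition pendant (V : finType) t r (F : {set {set V}}) (x : V) : {set {set V}} :=
  [set D : {set V} | [&& x \notin D, x |: D \in F &
     [pick y | centered t r F (x |: D) y] == Some x]].

Definition sparse (V : finType) t r (F : {set {set V}}) : {set {set V}} :=
  [set B in ksub [set: V] (r - 2) | ~~ robust t F B].

Lemma pendant_card (V : finType) t r (F : {set {set V}}) x D :
  2 < r -> is_rgraph r F -> D \in pendant t r F x -> #|D| = (r - 2).+1.
Proof.
move=> r3 /forall_inP Fr; rewrite inE => /and3P[xD /Fr + _].
by rewrite cardsU1 xD; lia.
Qed.

(** The two conditions of [centered] for [x |: D]. They place the shadow of [pendant t r F x] among
    the sparse sets with apex [x], as needed for [shadow_bound]. *)
Lemma pendant_apex (V : finType) t r (F : {set {set V}}) x D v :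
  2 < r -> is_rgraph r F -> D \in pendant t r F x -> v \in D ->
  D :\ v \in sparse t r F /\ x \in apex t F (D :\ v).
Proof.
move=> r3 Fr Dx vD; have cardD := pendant_card r3 Fr Dx.
move: Dx; rewrite inE => /and3P[xD _]; case: pickP => // y cen /eqP[eqy].
move: cen; rewrite {y}eqy => /and3P[_ /forall_inP cod /forallP non].
have vx : v != x by apply: contraNneq xD => <-.
have cDv : #|D :\ v| == r - 2.
  by move: cardD; rewrite (cardsD1 v) vD add1n => /eqP.
split.
  rewrite inE inE subsetT cDv /=; have := non (D :\ v); rewrite cDv andbT.
  by rewrite setU1K // subD1set.
rewrite inE !inE negb_and xD orbT /=.
have -> : x |: D :\ v = (x |: D) :\ v.
  apply/setP => w; rewrite !inE; case: (eqVneq w x) => [->|] //=.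
  by rewrite eq_sym vx.
by apply: cod; rewrite !inE vx vD orbT.
Qed.

Lemma sum_pendant (V : finType) t r (F : {set {set V}}) :
  #|F| <= #|[set e in F | ~~ [exists x, centered t r F e x]]| +
          \sum_(x : V) #|pendant t r F x|.
Proof.
set N := [set e in F | _].
have sub : F \subset N :|: \bigcup_(x : V) (fun D : {set V} => x |: D) @: pendant t r F x.
  apply/subsetP => e eF; rewrite in_setU; have [eN|] := boolP (e \in N) => //=.
  rewrite inE eF negbK => /existsP[y0 y0c].
  case Ep: [pick y | centered t r F e y] => [x|]; last first.
    by move: Ep; case: pickP => // none; have := none y0; rewrite y0c.
  have xe : x \in e.
    by move: Ep; case: pickP => // y /and3P[ye _ _] [<-].
  apply/bigcupP; exists x => //; apply/imsetP; exists (e :\ x); last by rewrite setD1K.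
  by rewrite inE setD1K // eF Ep !inE !eqxx.
apply: leq_trans (subset_leq_card sub) _; apply: leq_trans (leq_card_setU _ _) _.
rewrite leq_add2l; apply: leq_trans (card_bigcup_leq _ _) _.
by apply: leq_sum => x _; apply: leq_imset_card.
Qed.

(** Below the threshold [M ^ (r - 2)], [shadow_bound] with [k = r - 2] applies to
    [pendant t r F x]. *)
Definition heavy (V : finType) t r (F : {set {set V}}) M : {set V} :=
  [set x | M ^ (r - 2) <= #|[set B in sparse t r F | x \in apex t F B]|].

Lemma sum_sparse_apex (V : finType) t r (F : {set {set V}}) :
  \sum_(x : V) #|[set B in sparse t r F | x \in apex t F B]| <=
    t * 'C(#|V|, r - 2).
Proof.
have := double_count setT (sparse t r F) (fun x B => x \in apex t F B).
under eq_bigl do rewrite inE; move=> ->.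
apply: (@leq_trans (\sum_(B in sparse t r F) t)).
  apply: leq_sum => B; rewrite inE => /andP[_ /card_apex]; apply: leq_trans.
  by apply/subset_leq_card/subsetP => x; rewrite inE => /andP[].
rewrite sum_nat_const mulnC leq_mul2l -card_ksub; apply/orP; right.
by apply/subset_leq_card/subsetP => B; rewrite inE => /andP[].
Qed.

Lemma card_heavy (V : finType) t r (F : {set {set V}}) M :
  #|heavy t r F M| * M ^ (r - 2) <= t * 'C(#|V|, r - 2).
Proof.
apply: leq_trans (sum_sparse_apex t r F).
rewrite -sum_nat_const (bigID (mem (heavy t r F M)) predT) /=.
apply: leq_trans (leq_addr _ _); apply: leq_sum => x.
by rewrite inE.
Qed.

Lemma sum_light (V : finType) t r (F : {set {set V}}) M :
  2 < r -> is_rgraph r F ->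
  \sum_(x | x \notin heavy t r F M) #|pendant t r F x| <=
    M * (t * 'C(#|V|, r - 2)).
Proof.
move=> r3 Fr.
apply: (@leq_trans (\sum_(x : V) M * #|[set B in sparse t r F | x \in apex t F B]|)).
  rewrite [X in _ <= X](bigID (mem (heavy t r F M))) /=.
  apply: leq_trans (leq_addl _ _); apply: leq_sum => x.
  rewrite inE -ltnNge => lt; apply: shadow_bound lt.
  - by move=> D /(pendant_card r3 Fr).
  - by move=> B; rewrite !inE => /andP[/andP[/andP[_ /eqP]]].
  - move=> D v Dx vD; have [Ds xa] := pendant_apex r3 Fr Dx vD.
    by rewrite inE Ds.
by rewrite -big_distrr leq_mul2l sum_sparse_apex orbT.
Qed.

Definition common_apex (V : finType) t r (F : {set {set V}}) (A : {set V}) :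
    {set {set V}} :=
  [set B in ksub [set: V] (r - 2) | [disjoint B & A] &&
     [forall a in A, robust t F (a |: B)]].

Definition heavy_apex (V : finType) t r (F : {set {set V}}) M (B : {set V}) :=
  apex t F B :&: heavy t r F M.

Definition crowded (V : finType) t r (F : {set {set V}}) M sg : {set {set V}} :=
  [set B in ksub [set: V] (r - 2) | sg <= #|heavy_apex t r F M B|].

Definition over_crowded (V : finType) t r (F : {set {set V}}) M sg : {set {set V}} :=
  [set D in ksub [set: V] (r - 2).+1 |
     [exists B in crowded t r F M sg, B \subset D]].

Definition heavy_centers (V : finType) t r (F : {set {set V}}) M (D : {set V}) :
    {set V} :=
  [set x in heavy t r F M | D \in pendant t r F x].

(** A crowded set is a common apex set of some [sg] heavy vertices, and there are at most
    [#|heavy t r F M| ^ sg] choices of these. *)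
Lemma card_crowded (V : finType) t r (F : {set {set V}}) M sg c :
  (forall A : {set V}, #|A| = sg -> #|common_apex t r F A| <= c) ->
  #|crowded t r F M sg| <= #|heavy t r F M| ^ sg * c.
Proof.
move=> Ac.
apply: (@leq_trans (\sum_(A in ksub (heavy t r F M) sg) #|common_apex t r F A|)).
  have sub : crowded t r F M sg \subset
      \bigcup_(A in ksub (heavy t r F M) sg) common_apex t r F A.
    apply/subsetP => B; rewrite inE => /andP[Bk /subset_of_card[A AB Asg]].
    move: AB; rewrite subsetI => /andP[/subsetP Aap Ah]; apply/bigcupP; exists A.
      by rewrite inE Ah Asg eqxx.
    rewrite inE Bk /=; apply/andP; split.
      rewrite disjoint_sym disjoints_subset; apply/subsetP => a /Aap.
      by rewrite !inE => /andP[].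
    by apply/forall_inP => a /Aap; rewrite inE => /andP[].
  exact: leq_trans (subset_leq_card sub) (card_bigcup_leq _ _).
apply: (@leq_trans (\sum_(A in ksub (heavy t r F M) sg) c)).
  by apply: leq_sum => A; rewrite inE => /andP[_ /eqP/Ac].
rewrite sum_nat_const leq_mul2r; apply/orP; right.
apply: leq_trans (bin_leq_exp _ _); rewrite -cards_draws.
by apply/subset_leq_card/subsetP => A; rewrite !inE.
Qed.

Lemma card_over_crowded (V : finType) t r (F : {set {set V}}) M sg :
  #|over_crowded t r F M sg| <= #|crowded t r F M sg| * #|V|.
Proof.
rewrite -cardsT -cardsX; apply: leq_trans (leq_imset_card (fun p => p.2 |: p.1) _).
apply/subset_leq_card/subsetP => D; rewrite inE => /andP[Dk /exists_inP[B Bc BD]].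
have cD : #|D| = (r - 2).+1 by move: Dk; rewrite inE => /andP[_ /eqP].
have cB : #|B| = r - 2 by move: Bc; rewrite !inE => /andP[/andP[_ /eqP]].
have [v vD vB] : exists2 v, v \in D & v \notin B.
  apply/subsetPn/negP => /subset_leq_card; by rewrite cD cB ltnn.
apply/imsetP; exists (B, v) => /=; first by apply/setXP; rewrite Bc in_setT.
by apply/eqP; rewrite eq_sym eqEcard subUset sub1set vD BD cardsU1 vB cD cB add1n leqnn.
Qed.

(** This bounds the number of centers of [D] by the apexes of any [D :\ v], and it lets two
    [(r-1)]-sets sharing an [(r-2)]-set be compared. *)
Lemma heavy_centers_sub (V : finType) t r (F : {set {set V}}) M (D : {set V}) v :
  2 < r -> is_rgraph r F -> v \in D ->
  heavy_centers t r F M D \subset heavy_apex t r F M (D :\ v).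
Proof.
move=> r3 Fr vD; apply/subsetP => x; rewrite inE => /andP[xh Dx].
by have [_ xa] := pendant_apex r3 Fr Dx vD; rewrite inE xa.
Qed.

Lemma card_heavy_centers (V : finType) t r (F : {set {set V}}) M (D : {set V}) :
  2 < r -> is_rgraph r F -> #|heavy_centers t r F M D| <= t.
Proof.
move=> r3 Fr; have [->|/set0Pn[x]] := eqVneq (heavy_centers t r F M D) set0.
  by rewrite cards0.
move=> /[dup] xD; rewrite inE => /andP[xh Dx].
have /card_gt0P[v vD] : 0 < #|D| by rewrite (pendant_card r3 Fr Dx).
have [Ds _] := pendant_apex r3 Fr Dx vD.
apply: (@leq_trans #|apex t F (D :\ v)|); last first.
  by apply: card_apex; move: Ds; rewrite inE => /andP[].
apply/subset_leq_card/(subset_trans (heavy_centers_sub t M r3 Fr vD)).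
exact: subsetIl.
Qed.

Lemma card_heavy_centers_not_crowded (V : finType) t r (F : {set {set V}}) M sg (D : {set V}) :
  2 < r -> is_rgraph r F -> D \in ksub setT (r - 2).+1 ->
  D \notin over_crowded t r F M sg.+1 -> #|heavy_centers t r F M D| <= sg.
Proof.
move=> r3 Fr Dk; rewrite inE Dk negb_exists_in => /forall_inP non.
move: Dk; rewrite inE subsetT /= => /eqP cD.
have /card_gt0P[v vD] : 0 < #|D| by rewrite cD.
apply: leq_trans (subset_leq_card (heavy_centers_sub t M r3 Fr vD)) _.
rewrite leqNgt; apply/negP => lt.
suff Bc : D :\ v \in crowded t r F M sg.+1 by have := non _ Bc; rewrite subD1set.
by rewrite !inE subsetT lt andbT /=; move: cD; rewrite (cardsD1 v) vD add1n => -[->].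
Qed.

(* sg stands for sigma - 1, and j for n^(1/((r-2)(sigma+1))).  Irr counts the
   (r-1)-sets that do not have exactly sigma - 1 well-behaved centers. *)
Lemma stability_count (V : finType) t r sg c0 (F : {set {set V}}) j :
  3 < r -> is_rgraph r F -> 0 < j -> j ^ ((r - 2) * sg.+2) <= #|V| ->
  sg <= #|V| ->
  #|[set e in F | ~~ [exists x, centered t r F e x]]| <= c0 * 'C(#|V|, r - 2) ->
  (forall A : {set V}, #|A| = sg.+1 -> #|common_apex t r F A| <= t * 'C(#|V|, r - 3)) ->
  exists (A : {set V}) (Irr X : nat),
    [/\ #|A| = sg,
        j * X <= (c0 + 2 * t + t.+1 * t ^ sg.+2) * #|V| ^ (r - 1),
        Irr + #|F| <= sg * 'C(#|V|, r - 1) + X &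
        'C(#|V|, r - 1) <=
          #|[set D in common_link F A | #|D| == r - 1]| + (r - 1) * Irr].
Proof.
move=> r4 Fr j0 jn sgn few common; set n := #|V| in jn sgn few common *.
have r3 : 2 < r by lia.
have r1 : r - 1 = (r - 2).+1 by lia.
have nj : j <= n.
  by apply: leq_trans jn; rewrite -{1}(expn1 j) leq_pexp2l // muln_gt0 subn_gt0 r3.
have n0 : 0 < n by apply: leq_trans nj.
(* [M] is about [n / j]: from [n <= M * j] there are at most [t * j ^ (r - 2)] heavy vertices, and
   from [j * M <= 2 * n] the edges with light centers number [O(n ^ (r - 1) / j)]. *)
pose M := (n %/ j).+1.
have nM : n <= M * j by rewrite (ltnW (ltn_ceil _ _)).
have Mj : j * M <= 2 * n.
  by rewrite /M mulnS mul2n -addnn leq_add // mulnC leq_trunc_div.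
pose hv := #|heavy t r F M|.
have hvle : hv <= t * j ^ (r - 2).
  have pos : 0 < n ^ (r - 2) by rewrite expn_gt0 n0.
  rewrite -(leq_pmul2r pos).
  apply: (@leq_trans (hv * (M * j) ^ (r - 2))).
    by rewrite leq_mul2l leq_exp2r ?nM ?orbT // subn_gt0.
  rewrite expnMn mulnA.
  apply: (@leq_trans (t * 'C(n, r - 2) * j ^ (r - 2))); first by rewrite leq_mul2r card_heavy orbT.
  by rewrite mulnAC leq_mul2l bin_leq_exp orbT.
pose OC := over_crowded t r F M sg.+1.
(* Choosing [sg.+1] heavy vertices costs a constant times [j ^ ((r - 2) * sg.+1)]; the assumption on
   [j] leaves room for one further factor [j] below [n]. This explains the exponent of [j]. *)
have OCle : j * #|OC| <= t ^ sg.+2 * n ^ (r - 1).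
  have := card_over_crowded t r F M sg.+1; have := card_crowded M common.
  rewrite -/OC -/hv -/n => le1 le2.
  have le3 : #|OC| <= (t * j ^ (r - 2)) ^ sg.+1 * (t * n ^ (r - 3)) * n.
    apply: leq_trans le2 _; rewrite leq_mul2r (leq_trans le1) ?orbT //.
    apply: leq_mul; first by rewrite leq_exp2r.
    by rewrite leq_mul2l bin_leq_exp orbT.
  apply: leq_trans (_ : j * ((t * j ^ (r - 2)) ^ sg.+1 * (t * n ^ (r - 3)) * n) <= _).
    by rewrite leq_mul2l le3 orbT.
  have -> : j * ((t * j ^ (r - 2)) ^ sg.+1 * (t * n ^ (r - 3)) * n) =
      t ^ sg.+2 * ((j * j ^ ((r - 2) * sg.+1)) * (n ^ (r - 3) * n)).
    by rewrite expnMn -expnM (expnS t sg.+1); lia.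
  rewrite leq_mul2l; apply/orP; right.
  have -> : r - 1 = 1 + (r - 3).+1 by lia.
  rewrite -expnSr (expnD n 1) expn1 leq_mul2r; apply/orP; right.
  apply: leq_trans jn; rewrite -expnS leq_pexp2l //.
  by rewrite (mulnS (r - 2) sg.+1); lia.
pose Dk := ksub [set: V] (r - 2).+1.
pose lam D := if (D \in OC) || (#|heavy_centers t r F M D| < sg) then None
  else Some (heavy_centers t r F M D).
have lamS D A : D \in Dk -> lam D = Some A ->
    [/\ A = heavy_centers t r F M D, #|A| = sg & D \notin OC].
  rewrite /lam => Dk'; case: ifP => // /negbT; rewrite negb_or -leqNgt.
  case/andP=> nOC ge [<-]; split => //; apply/eqP; rewrite eqn_leq ge andbT.
  exact: card_heavy_centers_not_crowded nOC.
(* Both labels are [sg]-subsets of the heavy apexes of [D :&: D'], and there are at most [sg] of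
   those because [D] is not over-crowded. *)
have compat D D' a b : D \in Dk -> D' \in Dk -> #|D :&: D'| = r - 2 ->
    lam D = Some a -> lam D' = Some b -> a = b.
  move=> Dk1 Dk2 cap lD lD'; have [eqa ca nOC] := lamS D a Dk1 lD.
  have [eqb cb _] := lamS D' b Dk2 lD'.
  have hD (E : {set V}) : E \in Dk -> D :&: D' \subset E -> 
      heavy_centers t r F M E \subset heavy_apex t r F M (D :&: D').
    rewrite inE subsetT /= => /eqP cE sub.
    have [v vE vDD] : exists2 v, v \in E & v \notin D :&: D'.
      by apply/subsetPn/negP => /subset_leq_card; rewrite cE cap ltnn.
    suff -> : D :&: D' = E :\ v by apply: heavy_centers_sub.
    apply/eqP; rewrite eqEcard; apply/andP; split; first by rewrite subsetD1 sub.
    by move: cE; rewrite (cardsD1 v) vE add1n cap => -[->].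
  have le : #|heavy_apex t r F M (D :&: D')| <= sg.
    move: nOC; rewrite inE Dk1 negb_exists_in => /forall_inP non.
    rewrite leqNgt; apply/negP => lt.
    suff Bc : D :&: D' \in crowded t r F M sg.+1.
      by have := non _ Bc; rewrite subsetIl.
    by rewrite !inE subsetT cap eqxx lt.
  have -> : a = heavy_apex t r F M (D :&: D').
    by apply/eqP; rewrite eqEcard ca le andbT eqa hD ?subsetIl.
  by apply/eqP; rewrite eq_sym eqEcard cb le andbT eqb hD ?subsetIr.
have [l lP] := majority_label set0 compat.
set Irr := #|[set D in _ | lam D == None]| in lP.
have DkE : #|Dk| = 'C(n, r - 1) by rewrite card_ksub r1.
have DkS l' : #|Dk| <= #|[set D in Dk | lam D == Some l']| + #|[set D in Dk | lam D != Some l']|.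
  rewrite -(cardsID [set D | lam D == Some l']) leq_add //; apply/subset_leq_card/subsetP => D;
  by rewrite !inE // andbC.
have [A [Asg Alink]] : exists A : {set V}, #|A| = sg /\ 
    #|Dk| <= #|[set D in Dk | lam D == Some A]| + (r - 1) * Irr.
  (* A majority label of the wrong size labels no set at all; then [(r - 1) * Irr] already exceeds
     or equals [#|Dk|], and any [A] of size [sg] will do. *)
  have [lsg|lsg] := eqVneq #|l| sg.
    by exists l; split => //; apply: leq_trans (DkS l) _; rewrite leq_add2l r1.
  have [A _ Asg] : exists2 A : {set V}, A \subset setT & #|A| = sg.
    by apply: subset_of_card; rewrite cardsT.
  exists A; split => //; apply: leq_trans (leq_addl _ _).
  apply: leq_trans (DkS l) _; rewrite (_ : [set D in Dk | lam D == Some l] = set0).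
    by rewrite cards0 r1.
  apply/setP => D; rewrite in_set0 inE; apply/negP => /andP[Dk1 /eqP].
  by case/(lamS D l Dk1) => _ /eqP; rewrite (negbTE lsg).
(* The three terms of [X]: uncentered edges, edges with a light center, and the surplus of centers
   on over-crowded sets. *)
exists A, Irr, (c0 * 'C(n, r - 2) + M * (t * 'C(n, r - 2)) + t.+1 * #|OC|); split => //.
- have binle : j * 'C(n, r - 2) <= n ^ (r - 1).
    by rewrite r1 expnS leq_mul // bin_leq_exp.
  have binle2 : j * M * 'C(n, r - 2) <= 2 * n ^ (r - 1).
    by rewrite r1 expnS mulnA leq_mul // bin_leq_exp.
  have -> : j * (c0 * 'C(n, r - 2) + M * (t * 'C(n, r - 2)) + t.+1 * #|OC|) =
    c0 * (j * 'C(n, r - 2)) + t * (j * M * 'C(n, r - 2)) + t.+1 * (j * #|OC|) by lia.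
  rewrite (mulnDl (c0 + 2 * t)) (mulnDl c0); apply: leq_add; first apply: leq_add.
  + by rewrite leq_mul2l binle orbT.
  + by rewrite (mulnC 2 t) -(mulnA t 2) leq_mul2l binle2 orbT.
  + by rewrite -mulnA leq_mul2l OCle orbT.
- have := sum_pendant t r F; rewrite (bigID (mem (heavy t r F M))) /=.
  have -> : \sum_(x in heavy t r F M) #|pendant t r F x| =
            \sum_(D in Dk) #|heavy_centers t r F M D|.
    rewrite -(double_count _ _ (fun x D => D \in pendant t r F x)).
    apply: eq_bigr => x _; apply: eq_card => D; rewrite inE.
    case Dx: (D \in pendant t r F x); rewrite ?andbF // andbT.
    by rewrite !inE subsetT (pendant_card r3 Fr Dx) eqxx.
  have light := sum_light t M r3 Fr.
  (* Checked for each [D]: in [OC] there are at most [t] centers, and [Irr] adds 1; outside [OC]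
     there are at most [sg], and fewer than [sg] if [D] counts for [Irr]. *)
  have : \sum_(D in Dk) #|heavy_centers t r F M D| + Irr <=
      sg * 'C(n, r - 1) + t.+1 * #|OC|.
    have -> : Irr = \sum_(D in Dk) (lam D == None : nat).
      rewrite /Irr -sum1dep_card big_mkcondr.
      by apply: eq_bigr => D _; case: eqP.
    have -> : #|OC| = \sum_(D in Dk) (D \in OC : nat).
      rewrite -sum1_card (eq_bigl (fun D => (D \in Dk) && (D \in OC))).
        by rewrite big_mkcondr; apply: eq_bigr => D _; case: (D \in OC).
      by move=> D; rewrite inE; case: (D \in Dk).
    rewrite -DkE -big_split mulnC -sum_nat_const big_distrr -big_split /=.
    apply: leq_sum => D Dk1; rewrite /lam.
    have [DOC|DOC] := boolP (D \in OC) => /=.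
      by rewrite muln1; have := card_heavy_centers t M D r3 Fr; lia.
    have := card_heavy_centers_not_crowded r3 Fr Dk1 DOC.
    by case: ltnP => /=; lia.
  move=> h1 h0; have := leq_trans h0 (leq_add few (leq_add (leqnn _) light)).
  rewrite -/n; move: h1; move: (\sum_(D in Dk) _) => S; move: #|F| => f.
  rewrite -/Irr -/OC; move: #|OC| => oc; clear -f S; lia.
- rewrite -DkE; apply: leq_trans Alink _; rewrite leq_add2r.
  apply/subset_leq_card/subsetP => D; rewrite inE => /andP[Dk1 /eqP].
  case/(lamS D A Dk1) => -> cA nOC.
  have cD : #|D| == r - 1 by move: Dk1; rewrite inE r1 => /andP[].
  rewrite !inE cD andbT; apply/andP; split.
    by apply/subsetP => a aD; rewrite !inE; apply/negP => /andP[_ /andP[/negP]].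
  by apply/forall_inP => a; rewrite !inE setUC => /andP[_ /and3P[]].
Qed.

(** * Bounded trees and cross-cuts *)

Lemma embeddable_trans (U V W : finType) (H : {set {set U}}) (G : {set {set V}})
    (F : {set {set W}}) :
  embeddable H G -> embeddable G F -> embeddable H F.
Proof.
move=> [f finj fG] [g ginj gF]; exists (g \o f); first exact: inj_comp.
by move=> e /fG/gF; rewrite imset_comp.
Qed.

Definition tree_like (V : finType) r (H : {set {set V}}) m : Prop :=
  exists (W : finType) (T : {set {set W}}),
    [/\ #|W| <= m, is_rtree r T, reducible2 T & embeddable H T].

(** Up to isomorphism there are finitely many hypergraphs on [s] vertices; take one tree for each
    and the largest of their sizes. Thus the kernel parameter depends only on [r] and [s]. *)
Lemma tree_like_bound r s : exists m, forall (V : finType) (H : {set {set V}}),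
  #|V| = s ->
  (exists (W : finType) (T : {set {set W}}),
     [/\ is_rtree r T, reducible2 T & embeddable H T]) ->
  tree_like r H m.
Proof.
have /fin_all_exists[m mP] (H0 : {set {set 'I_s}}) : exists m : nat,
    (exists (W : finType) (T : {set {set W}}),
     [/\ is_rtree r T, reducible2 T & embeddable H0 T]) -> tree_like r H0 m.
  have [[W [T [? ? ?]]]|no] := boolp.EM (exists (W : finType) (T : {set {set W}}),
     [/\ is_rtree r T, reducible2 T & embeddable H0 T]); last by exists 0.
  by exists #|W| => _; exists W, T.
exists (\max_H0 m H0) => V H Vs [W [T [Ttree Tred HT]]].
pose f (v : V) := cast_ord Vs (enum_rank v); pose g i := enum_val (cast_ord (esym Vs) i).
have finj : injective f by move=> v w /cast_ord_inj/enum_rank_inj.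
have gf : cancel f g by move=> v; rewrite /g /f cast_ordK enum_rankK.
have fg : cancel g f by move=> v; rewrite /g /f enum_valK cast_ordKV.
pose H0 := [set f @: e | e : {set V} in H].
have HH0 : embeddable H H0 by exists f => // e eH; apply: imset_f.
have H0H : embeddable H0 H.
  exists g => [|_ /imsetP[e eH ->]]; first exact: can_inj fg.
  by rewrite -imset_comp (eq_imset _ gf) imset_id.
have [|W' [T' [W'm T'tree T'red H0T']]] := mP H0.
  by exists W, T; split => //; apply: embeddable_trans HT.
exists W', T'; split => //; last exact: embeddable_trans H0T'.
apply: leq_trans W'm _; exact: leq_bigmax.
Qed.

Lemma tree_like_cross_cut (V : finType) r m (H : {set {set V}}) :
  tree_like r H m -> exists S, cross_cut H S.
Proof.
move=> [W [T [_ Ttree /forall_inP Tred [g ginj gT]]]].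
have key (e : {set V}) : e \in H -> exists v, (v \in e) && (degree T (g v) == 1).
  move=> eH; have := Tred _ (gT e eH); case/ltnW/card_gt0P => w.
  by rewrite inE => /andP[/imsetP[v ve ->] w1]; exists v; rewrite ve.
pose pk (e : {set V}) := [pick v in e | degree T (g v) == 1].
exists [set v | [exists e in H, pk e == Some v]]; apply/forall_inP => e eH.
have [v0 v0P] := key e eH.
have pkP e' v : pk e' = Some v -> v \in e' /\ degree T (g v) == 1.
  by rewrite /pk; case: pickP => // u /andP[? ?] [<-].
have [v pv] : exists v, pk e = Some v.
  by rewrite /pk; case: pickP => [v _|/(_ v0)]; [exists v | rewrite v0P].
have [ve v1] := pkP e v pv.
apply/cards1P; exists v; apply/setP => w; rewrite !inE; apply/andP/eqP => [[we]|->].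
  case/exists_inP => e' e'H /eqP pe'; have [we' w1] := pkP e' w pe'.
  have eqg : g @: e = g @: e'.
    by apply: (degree1_edge w1 (gT e eH) (gT e' e'H)); apply: imset_f.
  by move: pe'; rewrite -(imset_inj ginj eqg) pv => -[].
by split => //; apply/exists_inP; exists e => //; apply/eqP.
Qed.

Lemma bigmin_leq (I : eqType) (s : seq I) (P : pred I) (f : I -> nat) x0 i :
  i \in s -> P i -> \big[minn/x0]_(j <- s | P j) f j <= f i.
Proof.
elim: s => // j s IH; rewrite inE big_cons => /predU1P[<- ->|/IH le Pi]; first exact: geq_minl.
by case: ifP => _; [apply: leq_trans (geq_minr _ _) _|]; apply: le.
Qed.

Lemma cross_cut_numberP (V : finType) (H : {set {set V}}) :
  (exists S, cross_cut H S) ->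
  exists2 S : {set V}, cross_cut H S & #|S| = cross_cut_number H.
Proof.
move=> [S0 S0H]; have [S SH Smin] := arg_minnP (fun S : {set V} => #|S|) S0H.
exists S => //; apply/eqP; rewrite eqn_leq; apply/andP; split; last first.
  by apply: bigmin_leq => //; rewrite mem_index_enum.
apply: (big_ind (fun x => #|S| <= x)) => //; first exact: max_card.
by move=> x y Sx Sy; rewrite leq_min Sx.
Qed.

(** The edges [a |: D] with [a] in [A] and [D] in the common link meet [A] exactly in [a], so they
    are pairwise distinct and none is counted by [not_meeting_once]. *)
Lemma not_meeting_once_count (V : finType) r (F : {set {set V}}) (A : {set V}) :
  #|not_meeting_once F A| + #|A| * #|[set D in common_link F A | #|D| == r]| <= #|F|.
Proof.
set CL := [set D in _ | _]; rewrite -cardsX.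
have CLA D : D \in CL -> D :&: A = set0.
  by rewrite !inE => /andP[/andP[DA _] _]; apply/eqP; rewrite setI_eq0 disjoints_subset.
pose h (p : V * {set V}) := p.1 |: p.2.
have hA a D : a \in A -> D \in CL -> h (a, D) :&: A = [set a].
  move=> aA /CLA DA; rewrite /h /= setIUl DA setU0; apply/setIidPl.
  by rewrite sub1set.
have hD a D : a \in A -> D \in CL -> h (a, D) :\: A = D.
  move=> aA /CLA DA; rewrite /h /= setDUl.
  have /eqP-> : [set a] :\: A == set0 by rewrite setD_eq0 sub1set.
  by rewrite set0U; apply/setDidPl; rewrite -setI_eq0 DA.
have hinj : {in setX A CL &, injective h}.
  move=> [a D] [a' D'] /setXP[/= aA DC] /setXP[/= a'A D'C] eq.
  congr pair; last by rewrite -(hD a D) // eq hD.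
  by apply: set1_inj; rewrite -(hA a D) // eq hA.
rewrite -(card_in_imset hinj) -(cardsID (not_meeting_once F A) F).
rewrite (setIidPr _); last by apply/subsetP => e; rewrite inE => /andP[].
rewrite leq_add2l; apply/subset_leq_card/subsetP => _ /imsetP[[a D] /setXP[/= aA DC] ->].
have hF : h (a, D) \in F.
  by move: DC; rewrite !inE => /andP[/andP[_ /forall_inP/(_ a aA)]]; rewrite setUC.
by rewrite inE hF andbT inE hF hA // cards1.
Qed.

(** Otherwise [full_subfamily], with all [(r-3)]-sets as [Z], extracts a full family disjoint from
    [A], and [cross_cut_embed] sends a minimum cross-cut of [H] to [A]. *)
Lemma few_common_apex (V W : finType) t r (H : {set {set W}}) (F : {set {set V}}) (A : {set V}) :
  3 < r -> is_rgraph r F -> tree_like r H t -> t <= #|V| -> ~ embeddable H F ->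
  #|A| = cross_cut_number H ->
  #|common_apex t r F A| <= t * 'C(#|V|, r - 3).
Proof.
move=> r4 Fr Ht tV Hfree cA; rewrite leqNgt; apply/negP => big.
have [S SH cS] := cross_cut_numberP (tree_like_cross_cut Ht).
have [W' [T [W't Ttree Tred [g ginj gT]]]] := Ht.
have ksubE : 'C(#|V|, r - 3) = #|ksub [set: V] (r - 3)| by rewrite card_ksub.
rewrite ksubE in big.
have [||B [BA B0 Bfull]] := @full_subfamily V (r - 2) t _ _ _ _ big.
- by move=> b; rewrite !inE => /andP[/andP[_ /eqP]].
- move=> b i; rewrite !inE => /andP[/andP[_ /eqP cb] _] ib; rewrite subsetT /=.
  by move: cb; rewrite (cardsD1 i) ib; lia.
have memB b : b \in B -> [/\ #|b| = r - 2, [disjoint b & A] &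
    forall a, a \in A -> robust t F (a |: b)].
  move/(subsetP BA); rewrite !inE => /andP[/andP[_ /eqP cb] /andP[dA /forall_inP]].
  by split.
apply: Hfree; apply: (@embeddable_trans _ _ _ _ [set g @: e | e : {set W} in H]).
  by exists g => // e eH; apply: imset_f.
apply: (@cross_cut_embed W' V t r T _ (g @: S) F B A) => //.
- exact: leq_trans W't tV.
- by apply/subsetP => _ /imsetP[e eH ->]; apply: gT.
- apply/forall_inP => _ /imsetP[e eH ->].
  by rewrite -imsetI ?card_imset ?(forall_inP SH) // => x y _ _; apply: ginj.
- by rewrite card_imset // cS cA.
- by move=> b /memB[].
- by move=> b /memB[].
- by move=> b a /memB[_ _ h] /h.
Qed.

Lemma stability_nat r s : 3 < r -> exists t C : nat,
  0 < C /\
  forall (V : finType) (H : {set {set V}}), #|V| = s ->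
    (exists (W : finType) (T : {set {set W}}),
       [/\ is_rtree r T, reducible2 T & embeddable H T]) ->
    2 <= cross_cut_number H ->
  cross_cut_number H <= s /\
  forall (U : finType) (F : {set {set U}}) j,
    t <= #|U| -> s <= #|U| -> is_rgraph r F -> ~ embeddable H F ->
    0 < j -> j ^ ((r - 2) * (cross_cut_number H).+1) <= #|U| ->
  exists (A : {set U}) (Irr X : nat),
    [/\ #|A| = cross_cut_number H - 1,
        j * X <= C * #|U| ^ (r - 1),
        Irr + #|F| <= (cross_cut_number H - 1) * 'C(#|U|, r - 1) + X &
        'C(#|U|, r - 1) <=
          #|[set D in common_link F A | #|D| == r - 1]| + (r - 1) * Irr].
Proof.
move=> r4; have [m mP] := tree_like_bound r s.
have [c0 c0P] := few_uncentered m (ltnW r4).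
(* The constant must serve every [H]: the exponent [sg.+2], which is the cross-cut number plus 1, is
   at most [s.+1]. The base [m.+1] keeps powers monotone when [m = 0], and the outer successor gives
   [0 < C]. *)
exists m, (c0 + 2 * m + m.+1 * m.+1 ^ s.+1).+1; split => // V H Vs Htree sg2.
have Ht := mP V H Vs Htree.
have [S SH cS] := cross_cut_numberP (tree_like_cross_cut Ht).
have sgs : cross_cut_number H <= s by rewrite -cS -Vs max_card.
split => // U F j mU sU Fr Hfree j0 jU.
have sgE : cross_cut_number H = (cross_cut_number H - 1).+1 by lia.
have [W [T [Wm Ttree Tred HT]]] := Ht.
have [||||A [Irr [X [cA jX le1 le2]]]] :=
  @stability_count U m r (cross_cut_number H - 1) c0 F j r4 Fr j0 _ _ _ _.
- by rewrite -sgE.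
- by lia.
- apply: (c0P W U T F) => //; first exact: leq_trans mU.
  by move/(embeddable_trans HT).
- move=> A; rewrite -sgE => cA; exact: few_common_apex cA.
exists A, Irr, X; split => //; apply: leq_trans jX _; rewrite leq_mul2r; apply/orP; right.
apply: leqW; rewrite leq_add2l leq_mul2l /=.
apply: (@leq_trans (m.+1 ^ (cross_cut_number H - 1).+2)).
  by rewrite leq_exp2r.
by rewrite leq_pexp2l // -sgE ltnS.
Qed.

(** * Real exponents and the final estimates *)

Import Order.TTheory GRing.Theory Num.Theory.
Local Open Scope ring_scope.

(* An integer scale j just above C n^(1/q). *)
Lemma integer_scale (R : realType) (C q Q n : nat) :
  (0 < C)%N -> (0 < q)%N -> (q <= Q)%N -> ((2 * C) ^ (Q * Q) <= n)%N ->
  exists j : nat, [/\ (0 < j)%N, C%:R * n%:R `^ (1 / q%:R) <= j%:R :> R &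
    (j ^ q.-1 <= n)%N].
Proof.
move=> C0 q0 qQ nbig; set y : R := n%:R `^ _.
have n0 : (0 < n)%N by apply: leq_trans nbig; rewrite expn_gt0 muln_gt0 C0.
have yq : y ^+ q = n%:R.
  rewrite -powR_mulrn ?powR_ge0 // -powRrM div1r mulVf ?powRr1 ?ler0n //.
  by rewrite pnatr_eq0 -lt0n.
have y0 : 0 <= y by apply: powR_ge0.
have C1 : 1 <= C%:R :> R by rewrite ler1n.
have ybig : ((2 * C) ^ q)%:R <= y.
  rewrite -(@ler_pXn2r _ q) ?nnegrE ?ler0n // yq -natrX ler_nat -expnM.
  apply: leq_trans nbig; rewrite leq_pexp2l ?muln_gt0 ?C0 // leq_mul //.
have y1 : 1 <= y.
  by apply: le_trans ybig; rewrite ler1n expn_gt0 muln_gt0 C0.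
have Cy0 : 0 <= C%:R * y by apply: mulr_ge0.
exists (Num.truncn (C%:R * y)).+1; split => //.
  by apply/ltW/truncnS_gt.
(* Rounding up costs at most a factor 2 as [C * y >= 1]; then [(2 * C) ^ q.-1 <= y] gives
   [j ^ q.-1 <= y ^ q = n]. *)
have jle : (Num.truncn (C%:R * y)).+1%:R <= (2 * C)%:R * y.
  rewrite -natr1 natrM -mulrA (mulr_natl _ 2) mulr2n lerD ?truncn_le //.
  by rewrite (le_trans C1) // ler_peMr // (le_trans ler01 C1).
rewrite -(ler_nat R) natrX -yq.
apply: (@le_trans _ _ (((2 * C)%:R * y) ^+ q.-1)).
  by rewrite lerXn2r ?nnegrE ?mulr_ge0 ?ler0n.
rewrite -(prednK q0) exprS /= exprMn ler_wpM2r ?exprn_ge0 //.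
apply: le_trans ybig; rewrite -natrX ler_nat leq_pexp2l ?leq_pred //.
by rewrite muln_gt0 C0.
Qed.

Theorem theorem4p2 (R : realType) (r s : nat) (hr : (4 <= r)%N) :
  exists n0 : nat,
  forall (V : finType) (H : {set {set V}}),
    #|V| = s -> is_rgraph r H ->
    (exists (W : finType) (T : {set {set W}}),
       [/\ is_rtree r T, reducible2 T & embeddable H T]) ->
    (2 <= cross_cut_number H)%N ->
  let sg : R := (cross_cut_number H)%:R in
  let beta : R := 1 / ((r%:R - 2) * (sg + 1) + 1) in
  forall (n : nat) (K : R) (F : {set {set 'I_n}}),
    (n0 <= n)%N -> 0 <= K ->
  let N : R := n%:R `^ (r%:R - 1 - beta) in
    is_rgraph r F -> ~ embeddable H F ->
    (#|F|)%:R >= (sg - 1) * ('C(n, r - 1))%:R - K * N ->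
  exists A : {set 'I_n},
    [/\ #|A| = (cross_cut_number H - 1)%N,
        (#|common_link F A|)%:R >=
          ('C(n, r - 1))%:R - (r%:R - 1) * (K + 2 * s%:R ^+ 2) * N
      & (#|not_meeting_once F A|)%:R <=
          ((sg - 1) * (r%:R - 1) * (K + 2 * s%:R ^+ 2) + 2 * s%:R ^+ 2) * N].
Proof.
have [t [C [C0 stab]]] := stability_nat s hr.
(* [1 / beta] is at most [Q] because the cross-cut number is at most [s]; this keeps the threshold
   independent of [H]. *)
pose Q := ((r - 2) * s.+1 + 1)%N.
exists (maxn (maxn t s) ((2 * C) ^ (Q * Q))) => V H Vs _ Htree sg2.
have [sgs {}stab] := stab V H Vs Htree sg2.
move: (cross_cut_number H) sg2 sgs stab => m sg2 sgs stab sg beta n K F.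
rewrite !geq_max => /andP[/andP[tn sn] nbig] K0 N Fr Hfree Fbig.
pose q := ((r - 2) * m.+1 + 1)%N.
have betaE : beta = 1 / q%:R.
  by rewrite /beta /q natrD natrM natrB ?(ltnW (ltnW hr)) // -(natr1 m).
have qQ : (q <= Q)%N by rewrite leq_add2r leq_mul2l ltnS sgs orbT.
have [|j [j0 jbig jn]] := @integer_scale R C q Q n C0 _ qQ nbig; first by rewrite /q addn1.
rewrite -betaE in jbig; rewrite /q addn1 /= in jn.
have [|||A [Irr [X [cA jX le1 le2]]]] := stab _ F j _ _ Fr Hfree j0; rewrite ?card_ord //.
rewrite !card_ord in jX le1 le2.
have n0 : 0 < n%:R :> R by rewrite ltr0n (leq_trans _ sn) // (leq_trans _ sgs) // ltnW.
have N0 : 0 <= N by apply: powR_ge0.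
have NE : n%:R ^+ (r - 1) = N * n%:R `^ beta.
  rewrite /N -powRD; last by rewrite (gt_eqF n0) implybT.
  by rewrite subrK -(natrB R (ltnW (ltnW (ltnW hr)))) powR_mulrn // ltW.
(* Here [j >= C * n ^ beta], while [j * X <= C * n ^ (r - 1) = C * N * n ^ beta]. *)
have XN : X%:R <= N.
  have Cy : 0 < C%:R * n%:R `^ beta by rewrite mulr_gt0 ?ltr0n ?powR_gt0.
  rewrite -(ler_pM2l Cy); apply: (@le_trans _ _ (j%:R * X%:R)).
    by rewrite ler_wpM2r ?ler0n.
  by rewrite -natrM -mulrA (mulrC (n%:R `^ _)) -NE -natrX -natrM ler_nat.
have mE : (m - 1)%:R = sg - 1 :> R by rewrite natrB ?(ltnW sg2).
have rE : (r - 1)%:R = r%:R - 1 :> R by rewrite natrB // (ltn_trans _ hr).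
have r0 : 0 <= r%:R - 1 :> R by rewrite -rE ler0n.
have m0 : 0 <= sg - 1 by rewrite -mE ler0n.
(* The error obtained is [N] itself, which fits under the constant [2 * s ^ 2] of the statement. *)
have s1 : 1 <= 2 * s%:R ^+ 2 :> R.
  have : 1 <= s%:R :> R by rewrite ler1n (leq_trans _ sgs) // ltnW.
  by nra.
rewrite -(ler_nat R) !natrD natrM mE in le1.
rewrite -(ler_nat R) natrD natrM rE in le2.
have IrrN : Irr%:R <= (K + 2 * s%:R ^+ 2) * N.
  have : N <= 2 * s%:R ^+ 2 * N by rewrite ler_peMl.
  by rewrite mulrDl; lra.
have rIrr : (r%:R - 1) * Irr%:R <= (r%:R - 1) * (K + 2 * s%:R ^+ 2) * N.
  by rewrite -mulrA ler_wpM2l.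
set CL := #|[set D in _ | _]| in le2.
have CLle : (CL <= #|common_link F A|)%N.
  by apply/subset_leq_card/subsetP => D; rewrite inE => /andP[].
have CLR : CL%:R <= #|common_link F A|%:R :> R by rewrite ler_nat.
exists A; split => //.
  by apply: le_trans CLR; rewrite lerBlDr (le_trans le2) // lerD2l.
(* The edges meeting [A] once number at least [(sg - 1) * CL]; subtracting this from the upper bound
   [le1] on [#|F|] leaves the exceptional edges. *)
have := not_meeting_once_count (r - 1)%N F A; rewrite -/CL cA.
rewrite -(ler_nat R) natrD natrM mE => nmo.
have h1 : (sg - 1) * ('C(n, r - 1)%:R - (r%:R - 1) * (K + 2 * s%:R ^+ 2) * N) <=
    (sg - 1) * CL%:R.
  by apply: ler_wpM2l => //; rewrite lerBlDr (le_trans le2) // lerD2l.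
have h2 : N <= 2 * s%:R ^+ 2 * N by rewrite ler_peMl.
have I0 : 0 <= Irr%:R :> R by rewrite ler0n.
clear - le1 nmo h1 h2 XN I0; lra.
Qed.
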